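(* Let $m\ge1$ be an integer, $\mathbf p=(p_1,\dots,p_m)\in[1,+\infty]^m$ with $\left|\frac1{\mathbf p}\right|:=\frac1{p_1}+\dots+\frac1{p_m}>\frac12$, let $1\le s\le q\le 2$ and let $\rho>0$. Consider the following property: (P) There exists $C>0$ such that, for every continuous $m$-linear operator $A:X_{p_1}\times\dots\times X_{p_m}\to X_s$, \[ \left(\sum_{i_1,\dots,i_m=1}^{+\infty}\|A(e_{i_1},\dots,e_{i_m})\|_{\ell_q}^{\rho}\right)^{1/\rho}\le C\|A\| . \] (A) If $s<2$ and \[ \frac1\rho\le\frac{\left(\frac1s-\frac1q\right)\left(\frac1s-\left|\frac1{\mathbf p}\right|\right)}{\frac1s-\frac12}, \] then (P) is satisfied. (B) If (P) is satisfied, then \[ \frac1\rho\le 2\left(1-\left|\frac1{\mathbf p}\right|\right)\left(\frac1s-\frac1q\right). \]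
   Context: Scalars are $\mathbb K=\mathbb R$ or $\mathbb C$. For $1\le p<+\infty$, $X_p:=\ell_p$, and $X_\infty:=c_0$ (with the sup norm); $(e_i)_{i\ge1}$ denotes the canonical unit vectors. Convention: $1/\infty=0$. Since $s\le q$, elements of $X_s$ belong to $\ell_q$ and $\|\cdot\|_{\ell_q}$ is their $\ell_q$-norm. $\|A\|$ is the usual norm of a multilinear operator, i.e. the supremum of $\|A(x^{(1)},\dots,x^{(m)})\|_{X_s}$ over $x^{(j)}$ in the closed unit ball of $X_{p_j}$. *)

(* Defs.v *)
From HB Require Import structures.
From mathcomp Require Import all_boot all_order all_algebra.
From mathcomp Require Import all_classical all_reals all_analysis.
From mathcomp Require Import complex.
Set Implicit Arguments.
Unset Strict Implicit.
Unset Printing Implicit Defensive.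
Import Order.TTheory GRing.Theory Num.Theory.
Import numFieldNormedType.Exports.
Local Open Scope classical_set_scope.
Local Open Scope ring_scope.

Variant scalar_kind := RealScalars | ComplexScalars.

Definition scalar (R : realType) (k : scalar_kind) : numFieldType :=
  match k with RealScalars => R | ComplexScalars => R[i] end.

(* The norm of [R[i]] as a numFieldType takes values in [R[i]]; [normc] is the
   same modulus with values in [R]. *)
Definition modulus (R : realType) (k : scalar_kind) : scalar R k -> R :=
  match k return scalar R k -> R with
  | RealScalars => fun x : R => `|x|
  | ComplexScalars => fun z : R[i] => ComplexField.Normc.normc z
  end.

Section SequenceSpaces.
Context (R : realType) (k : scalar_kind).
Local Notation K := (scalar R k).

(* Sequences are indexed from 0: [unit_seq i] is $e_{i+1}$. *)
Definition unit_seq (i : nat) : nat -> K := fun n => (n == i)%:R.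

Definition lp_norm (p : \bar R) (x : nat -> K) : \bar R :=
  Lnorm (@counting nat R) p (fun n => (modulus (x n))%:E).

(* $X_p$: $\ell_p$ for finite p, and $c_0$ (not $\ell_\infty$) for p = +oo. *)
Definition Xspace (p : \bar R) : set (nat -> K) :=
  if p == +oo%E then [set x | (fun n => modulus (x n)) @ \oo --> (0 : R)]
  else [set x | (lp_norm p x < +oo)%E].

Section Operators.
Context (m : nat) (p : 'I_m -> \bar R) (s : R).

(* Operators are functions on all families of sequences, of which only the
   restriction to the product of the $X_{p_j}$ is ever considered. *)
Implicit Types (A : ('I_m -> nat -> K) -> nat -> K) (x y : 'I_m -> nat -> K).

Definition Xprod : set ('I_m -> nat -> K) :=
  [set x | forall j, Xspace (p j) (x j)].

Definition multilinear_on A : Prop :=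
  forall x (j : 'I_m) (a : K) (u v : nat -> K),
    Xprod x -> Xspace (p j) u -> Xspace (p j) v ->
    A (@dfwith _ (fun=> nat -> K) x j (fun n => a * u n + v n)) =
    (fun n => a * A (@dfwith _ (fun=> nat -> K) x j u) n +
              A (@dfwith _ (fun=> nat -> K) x j v) n).

Definition continuous_on A : Prop :=
  forall x, Xprod x -> forall eps : R, 0 < eps ->
  exists2 delta : R, 0 < delta & forall y, Xprod y ->
    (forall j, lp_norm (p j) (fun n => y j n - x j n)%R < delta%:E)%E ->
    (lp_norm s%:E (fun n => A y n - A x n)%R < eps%:E)%E.

Definition continuous_multilinear A : Prop :=
  [/\ forall x, Xprod x -> Xspace s%:E (A x), multilinear_on A
    & continuous_on A].

Definition op_norm A : \bar R :=
  ereal_sup [set lp_norm s%:E (A x) | x in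
    [set x | Xprod x /\ forall j, (lp_norm (p j) (x j) <= 1)%E]].

Definition summing_property (q rho : R) : Prop :=
  exists2 C : R, 0 < C & forall A, continuous_multilinear A ->
    ((\esum_(i in [set: {ffun 'I_m -> nat}])
        lp_norm q%:E (A (fun j => unit_seq (i j))) `^ rho) `^ rho^-1
     <= C%:E * op_norm A)%E.

End Operators.
End SequenceSpaces.

(* In [\bar R], the inverse of +oo is 0. *)
Definition inv_sum (R : realType) (m : nat) (p : 'I_m -> \bar R) : R :=
  \sum_(j < m) fine ((p j)^-1)%E.

Arguments summing_property R k [m] p s q rho.

(* Main.v *)
Require Import Defs.
From HB Require Import structures.
From mathcomp Require Import all_boot all_order all_algebra.
From mathcomp Require Import all_classical all_reals all_analysis.
From mathcomp Require Import finmap ess_sup_inf.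
From mathcomp Require Import ring lra complex.
Set Implicit Arguments.
Unset Strict Implicit.
Unset Printing Implicit Defensive.
Import Order.TTheory GRing.Theory Num.Theory.
Import numFieldNormedType.Exports.
Local Open Scope ring_scope.

(** Write [u_j = 1/p_j] and [x] for the sum of the [u_j].

    Sufficiency. For [q = s] the summands are bounded by [||A||], so by
    interpolation it is enough to treat [q = 2], with exponent [r >= 2],
    [1/r = 1/s - x]. Truncate, let [a(i, n)] be the [n]-th entry of [A(e_i)] and
    treat [n] as one more coordinate, with [u_0 = 1 - 1/s]. Testing [A] on
    the vectors [+- w^(u_j)], where [w] is a probability weight, and applying
    Khintchine's inequality bounds, for each coordinate [j], the mixed
    [l_1(l_2)] norm of [a] times the product of the weights. Taking for the
    weights the marginals of the probability measure proportional to
    [|a(i, n)|^2 ||A(e_i)||_2^(r - 2)], and combining the bounds for the various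
    [j] by the weighted arithmetic-geometric mean inequality, makes the weights
    cancel and leaves the [l_r] sum of the [||A(e_i)||_2].

    Necessity. Test on [A(x) = sum_(i < n) x^1_i ... x^m_i v_i]; the vector of
    products runs in the unit ball of [l_(1/x)]. If [x >= 1], take the [v_i] to be
    unit vectors. Otherwise take the rows of a random [n * N] sign matrix with
    [N ~ n^(2 - 2x)]: up to logarithms it has norm [N^(1/s)] from [l_(1/x)]
    to [l_s], the rows have [l_q] norm [N^(1/q)], and [n] tends to infinity. *)

(** * Weighted inequalities for finite sums *)

(** Why the weights cancel: with shares [t_k] in the arithmetic-geometric mean inequality, the k-th
    marginal keeps the exponent u_k - t_k/2. The share t_0 = 2 u_0 removes the marginal of the entry
    index altogether. The remaining share, split in proportion to the u_j, leaves the exponents (u_j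
    / x)(1/2 - 1/r), nonnegative because 1/s <= 1 and x > 1/2 force r >= 2. Each marginal is at
    least the mass of the whole multi-index i, so the product is bounded below by a power of that
    mass.

    Why N ~ n^(2 - 2x): up to constants, a vector of the unit ball of l_(1/x) has k <= 2^(l/x)
    coordinates of size 2^(-l), and a random sign matrix sends this block to a vector of squared l_2
    norm at most 4^(-l) k (N + k log n). Here k <= 4^l since x > 1/2, and k^2 <= 4^l k^(2 - 2x) <=
    4^l n^(2 - 2x). So N >= n^(2 - 2x) makes each of the log n blocks cost at most N log n.
    Comparing n^(1/rho) N^(1/q) with N^(1/s) gives the exponent. *)

Lemma prod_powR (R : realType) (J : finType) (a : R) (t : J -> R) : 0 < a ->
  \prod_j a `^ t j = a `^ (\sum_j t j).
Proof.
move=> a0; elim/big_rec2 : _ => [|j y z _ ->]; first by rewrite powRr0.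
by rewrite powRD //; apply/implyP => _; rewrite gt_eqF.
Qed.

Lemma prod_powRl (R : realType) (J : finType) (x : J -> R) (t : R) :
  (forall j, 0 <= x j) -> \prod_j x j `^ t = (\prod_j x j) `^ t.
Proof.
move=> x0; suff [_ ->] : 0 <= \prod_j x j /\ \prod_j x j `^ t = (\prod_j x j) `^ t by [].
elim/big_rec2 : _ => [|j y z _ [z0 ->]]; first by rewrite powR1.
by rewrite mulr_ge0 // powRM.
Qed.

Lemma powR_div (R : realType) (x y t : R) : 0 <= x -> 0 <= y ->
  (x / y) `^ t = x `^ t / y `^ t.
Proof.
by move=> x0 y0; rewrite powRM ?invr_ge0 // -(powR_inv1 y0) -powRrM mulN1r powRN.
Qed.

(** With [a] the arithmetic mean, 1 + y <= exp y gives x_j <= a exp(x_j / a - 1). The exponents x_j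
    / a - 1 have weighted mean 0, so the exponentials multiply to 1. If a = 0, some x_j with t_j > 0
    vanishes. *)
Lemma weighted_AMGM (R : realType) (J : finType) (t x : J -> R) :
  (forall j, 0 <= t j) -> \sum_j t j = 1 -> (forall j, 0 <= x j) ->
  \prod_j x j `^ t j <= \sum_j t j * x j.
Proof.
move=> t0 t1 x0; set a := \sum_j t j * x j.
have tx0 j : 0 <= t j * x j by rewrite mulr_ge0.
have : 0 <= a by apply: sumr_ge0.
rewrite le_eqVlt => /predU1P[a0|a0].
  have [j tj] : exists j, 0 < t j.
    apply/existsP; rewrite -[X in is_true X]negbK negb_exists; apply/negP => /forallP h.
    have : \sum_j t j <= 0 by apply: sumr_le0 => j _; rewrite leNgt h.
    by rewrite t1 ler10.
  have /eqP : t j * x j = 0 by apply: (psumr_eq0P _ (esym a0)).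
  rewrite mulf_eq0 gt_eqF //= => /eqP xj.
  by rewrite (bigD1 j) //= xj powR0 ?gt_eqF // mul0r -a0.
have aE : a = a `^ (\sum_j t j) by rewrite t1 powRr1 // ltW.
rewrite [leRHS]aE -prod_powR //.
have -> : \prod_j a `^ t j = \prod_j (a * expR (x j / a - 1)) `^ t j.
  under [RHS]eq_bigr do rewrite powRM ?(ltW a0) ?expR_ge0 // -expRM.
  rewrite big_split /= -expR_sum.
  have -> : \sum_j (x j / a - 1) * t j = 0.
    under eq_bigr do rewrite mulrBl mul1r mulrAC [x _ * _]mulrC.
    by rewrite big_split /= -mulr_suml divff ?gt_eqF // sumrN t1 subrr.
  by rewrite expR0 mulr1.
apply: ler_prod => j _; rewrite powR_ge0 /=; apply: ge0_ler_powR; rewrite ?nnegrE //.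
  by rewrite mulr_ge0 // ?(ltW a0) ?expR_ge0.
rewrite -ler_pdivrMl // mulrC.
by rewrite (le_trans _ (expR_ge1Dx _)) // addrCA subrr addr0.
Qed.

Lemma weighted_AMGM2 (R : realType) (t x y : R) : 0 <= t -> t <= 1 ->
  0 <= x -> 0 <= y -> x `^ t * y `^ (1 - t) <= t * x + (1 - t) * y.
Proof.
move=> t0 t1 x0 y0.
have := @weighted_AMGM R bool (fun b => if b then t else 1 - t)
  (fun b => if b then x else y).
rewrite !big_bool /=; apply; [by case => //; rewrite subr_ge0|by ring|by case].
Qed.

(** Both sums are normalised to 1 and the two-term mean inequality is applied to each summand. *)
Lemma hoelder_sum (R : realType) (I : finType) (P : pred I) (t : R) (x y : I -> R) :
  0 <= t -> t <= 1 -> (forall i, 0 <= x i) -> (forall i, 0 <= y i) ->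
  \sum_(i | P i) x i `^ t * y i `^ (1 - t) <=
  (\sum_(i | P i) x i) `^ t * (\sum_(i | P i) y i) `^ (1 - t).
Proof.
move=> t0 t1 x0 y0.
have [->|tn0] := eqVneq t 0.
  rewrite powRr0 subr0 mul1r powRr1 ?sumr_ge0 //.
  by apply: ler_sum => i _; rewrite powRr0 mul1r powRr1.
have [->|tn1] := eqVneq t 1.
  rewrite subrr powRr0 mulr1 powRr1 ?sumr_ge0 //.
  by apply: ler_sum => i _; rewrite powRr0 mulr1 powRr1.
have s0 : 0 <= 1 - t by rewrite subr_ge0.
have sn0 : 1 - t != 0 by rewrite subr_eq0 eq_sym.
set X := \sum_(i | P i) x i; set Y := \sum_(i | P i) y i.
have : 0 <= X by apply: sumr_ge0.
rewrite le_eqVlt => /predU1P[X0|X0].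
  rewrite -X0 powR0 // mul0r big1 // => i Pi.
  have -> : x i = 0 by apply: (psumr_eq0P _ (esym X0)).
  by rewrite powR0 // mul0r.
have : 0 <= Y by apply: sumr_ge0.
rewrite le_eqVlt => /predU1P[Y0|Y0].
  rewrite -Y0 (powR0 sn0) mulr0 big1 // => i Pi.
  have -> : y i = 0 by apply: (psumr_eq0P _ (esym Y0)).
  by rewrite (powR0 sn0) mulr0.
have XY : 0 < X `^ t * Y `^ (1 - t) by rewrite mulr_gt0 ?powR_gt0.
rewrite -[leRHS]mulr1 -ler_pdivrMl // mulr_sumr.
apply: (@le_trans _ _ (\sum_(i | P i) (t * (x i / X) + (1 - t) * (y i / Y)))).
  apply: ler_sum => i Pi.
  apply: le_trans (weighted_AMGM2 t0 t1 _ _); rewrite ?divr_ge0 ?(ltW X0) ?(ltW Y0) //.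
  rewrite !powR_div ?(ltW X0) ?(ltW Y0) // invfM.
  by rewrite le_eqVlt; apply/orP; left; apply/eqP; ring.
rewrite big_split /= -!mulr_sumr -!mulr_suml !divff ?gt_eqF // !mulr1.
by rewrite addrC subrK.
Qed.

Lemma sqrt_powR (R : realType) (a : R) : 0 <= a -> Num.sqrt a = a `^ (1 / 2).
Proof. by move=> a0; rewrite -powR12_sqrt // div1r. Qed.

Lemma cauchy_schwarz_sum (R : realType) (I : finType) (P : pred I) (x y : I -> R) :
  (forall i, 0 <= x i) -> (forall i, 0 <= y i) ->
  \sum_(i | P i) x i * y i <=
  Num.sqrt (\sum_(i | P i) x i ^+ 2) * Num.sqrt (\sum_(i | P i) y i ^+ 2).
Proof.
move=> x0 y0; rewrite !sqrt_powR; last first.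
- by apply: sumr_ge0 => i _; apply: sqr_ge0.
- by apply: sumr_ge0 => i _; apply: sqr_ge0.
have h : 1 / 2 = 1 - 1 / 2 :> R by lra.
rewrite [X in _ * _ `^ X]h.
apply: le_trans (hoelder_sum P _ _ _ _) => //; try lra; try by move=> i; apply: sqr_ge0.
apply: ler_sum => i _; rewrite -h -!sqrt_powR ?sqr_ge0 //.
by rewrite !sqrtr_sqr !ger0_norm.
Qed.

(** Coordinate 0 is split off for inductions on the number of coordinates, and later to hold the
    entry index beside the indices of the unit vectors. *)
Definition fcons (T : Type) n (a : T) (g : {ffun 'I_n -> T}) : {ffun 'I_n.+1 -> T} :=
  [ffun k => oapp g a (unlift ord0 k)].

Lemma fcons0 (T : Type) n (a : T) (g : {ffun 'I_n -> T}) : fcons a g ord0 = a.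
Proof. by rewrite ffunE unlift_none. Qed.

Lemma fconsS (T : Type) n (a : T) (g : {ffun 'I_n -> T}) k :
  fcons a g (lift ord0 k) = g k.
Proof. by rewrite ffunE liftK. Qed.

Lemma big_fcons (R : nmodType) (T : finType) n (G : {ffun 'I_n.+1 -> T} -> R) :
  \sum_f G f = \sum_a \sum_(g : {ffun 'I_n -> T}) G (fcons a g).
Proof.
rewrite pair_big /=; rewrite (reindex (fun p : T * {ffun 'I_n -> T} => fcons p.1 p.2)) //=.
exists (fun f : {ffun 'I_n.+1 -> T} => (f ord0, [ffun k => f (lift ord0 k)])).
  move=> [a g] _ /=; rewrite fcons0; congr pair; apply/ffunP => k.
  by rewrite ffunE fconsS.
move=> f _ /=; apply/ffunP => k; rewrite ffunE.
by case: unliftP => [j ->|->] //=; rewrite ffunE.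
Qed.

Lemma big_ffun0 (R : nmodType) (T : finType) (G : {ffun 'I_0 -> T} -> R) f :
  \sum_g G g = G f.
Proof.
rewrite (big_pred1 f) // => g; apply/esym/eqP/ffunP => -[] //.
Qed.

(** * Khintchine inequalities *)

Lemma cauchy_schwarz_sqr (R : realType) (I : finType) (x y : I -> R) :
  (\sum_i x i * y i) ^+ 2 <= (\sum_i x i ^+ 2) * (\sum_i y i ^+ 2).
Proof.
have h : `|\sum_i x i * y i| <=
    Num.sqrt (\sum_i x i ^+ 2) * Num.sqrt (\sum_i y i ^+ 2).
  apply: le_trans (ler_norm_sum _ _ _) _.
  under eq_bigr do rewrite normrM.
  have := cauchy_schwarz_sum xpredT (fun i => normr_ge0 (x i)) (fun i => normr_ge0 (y i)).
  have E (z : I -> R) : \sum_i `|z i| ^+ 2 = \sum_i z i ^+ 2.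
    by apply: eq_bigr => i _; rewrite real_normK ?num_real.
  by rewrite !E.
have s0 (z : I -> R) : 0 <= \sum_i z i ^+ 2.
  by apply: sumr_ge0 => i _; apply: sqr_ge0.
rewrite -sqrtrM // in h.
by rewrite -[leLHS]real_normK ?num_real // -[leRHS]sqr_sqrtr ?mulr_ge0 // lerXn2r ?nnegrE ?sqrtr_ge0.
Qed.

Definition avg (R : realType) n (G : {ffun 'I_n -> bool} -> R) : R :=
  (\sum_e G e) / 2 ^+ n.

Lemma avg0 (R : realType) (G : {ffun 'I_0 -> bool} -> R) e : avg G = G e.
Proof. by rewrite /avg (big_ffun0 _ e) expr0 divr1. Qed.

Lemma avgS (R : realType) n (G : {ffun 'I_n.+1 -> bool} -> R) :
  avg G = avg (fun e => (G (fcons true e) + G (fcons false e)) / 2).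
Proof.
by rewrite /avg big_fcons big_bool -mulr_suml -big_split /= exprS invfM mulrA.
Qed.

Lemma ler_avg (R : realType) n (G H : {ffun 'I_n -> bool} -> R) :
  (forall e, G e <= H e) -> avg G <= avg H.
Proof. by move=> GH; rewrite ler_wpM2r ?invr_ge0 ?exprn_ge0 // ler_sum. Qed.

Lemma avg_cst (R : realType) n (a : R) : avg (fun _ : {ffun 'I_n -> bool} => a) = a.
Proof.
rewrite /avg sumr_const card_ffun card_bool card_ord -[_ *+ _]mulr_natr natrX mulfK //.

Qed.

Lemma avgD (R : realType) n (G H : {ffun 'I_n -> bool} -> R) :
  avg (fun e => G e + H e) = avg G + avg H.
Proof. by rewrite /avg big_split mulrDl. Qed.

Lemma avgZ (R : realType) n a (G : {ffun 'I_n -> bool} -> R) :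
  avg (fun e => a * G e) = a * avg G.
Proof. by rewrite /avg -mulr_sumr mulrA. Qed.

Lemma avg_sum (R : realType) (I : finType) n (G : I -> {ffun 'I_n -> bool} -> R) :
  avg (fun e => \sum_i G i e) = \sum_i avg (G i).
Proof. by rewrite /avg exchange_big -mulr_suml. Qed.

Lemma le_avg_ex (R : realType) n (G : {ffun 'I_n -> bool} -> R) :
  exists e, avg G <= G e.
Proof.
apply/existsP; rewrite -[X in is_true X]negbK negb_exists; apply/negP => /forallP h.
have : \sum_e G e < \sum_(e : {ffun 'I_n -> bool}) avg G.
  apply: ltr_sum => [|e _]; last by rewrite ltNge h.
  by apply/hasP; exists [ffun => true] => //; rewrite mem_index_enum.
rewrite sumr_const card_ffun card_bool card_ord -[_ *+ _]mulr_natr natrX /avg.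
by rewrite divfK ?ltxx // expf_neq0.
Qed.

(** A Rademacher sum of vectors of the Euclidean space with coordinates in [V]. The vector-valued
    form is what permits iteration: in [khintchine_chaos] the coordinates already treated are
    absorbed into [V]. *)
Definition signsum (R : realType) n (V : Type) (c : 'I_n -> V -> R)
  (e : {ffun 'I_n -> bool}) (v : V) : R := \sum_k (-1) ^+ e k * c k v.

Lemma signsumS (R : realType) n (V : Type) (c : 'I_n.+1 -> V -> R) b e v :
  signsum c (fcons b e) v =
  (-1) ^+ b * c ord0 v + signsum (fun k => c (lift ord0 k)) e v.
Proof.
rewrite /signsum big_ord_recl fcons0; congr (_ + _).
by apply: eq_bigr => k _; rewrite fconsS.
Qed.

Lemma avg_signsum_sqr (R : realType) n (V : finType) (c : 'I_n -> V -> R) :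
  avg (fun e => \sum_v signsum c e v ^+ 2) = \sum_k \sum_v c k v ^+ 2.
Proof.
elim: n c => [|n IH] c.
  rewrite (avg0 _ [ffun => true]) big_ord0 big1 // => v _.
  by rewrite /signsum big_ord0 expr0n.
rewrite avgS big_ord_recl -IH -[X in X + _](@avg_cst R n) -avgD.
congr avg; apply/funext => e; rewrite -!big_split /= mulr_suml.
by apply: eq_bigr => v _; rewrite !signsumS /= expr1 expr0; field.
Qed.

(** Averaging over the first sign leaves (a + S)^2 + 4 w^2, where w^2 <= a S by Cauchy-Schwarz,
    hence at most S^2 + 6 a S + a^2. The constant 3 is preserved because 3 T^2 + 6 a T + a^2 <= 3 (a
    + T)^2. *)
Lemma avg_signsum_pow4 (R : realType) n (V : finType) (c : 'I_n -> V -> R) :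
  avg (fun e => (\sum_v signsum c e v ^+ 2) ^+ 2) <=
  3 * (\sum_k \sum_v c k v ^+ 2) ^+ 2.
Proof.
elim: n c => [|n IH] c.
  rewrite (avg0 _ [ffun => true]) big_ord0 big1 ?expr0n ?mulr0 // => v _.
  by rewrite /signsum big_ord0 expr0n.
pose c' k := c (lift ord0 k).
pose S e := \sum_v signsum c' e v ^+ 2.
pose a := \sum_v c ord0 v ^+ 2; pose T := \sum_k \sum_v c' k v ^+ 2.
rewrite avgS big_ord_recl -/a -/T.
apply: (@le_trans _ _ (avg (fun e => S e ^+ 2 + (6 * a * S e + a ^+ 2)))).
  apply: ler_avg => e; pose w := \sum_v c ord0 v * signsum c' e v.
  have Eb (b : bool) : \sum_v signsum c (fcons b e) v ^+ 2 = a + (-1) ^+ b * 2 * w + S e.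
    rewrite /w mulr_sumr -!big_split /=; apply: eq_bigr => v _; rewrite signsumS.
    by case: b; rewrite ?expr1 ?expr0; ring.
  have w2 : w ^+ 2 <= a * S e by apply: cauchy_schwarz_sqr.
  by rewrite !Eb /= expr1 expr0; nra.
rewrite !avgD avgZ avg_cst avg_signsum_sqr -/T.
have a0 : 0 <= a by apply: sumr_ge0 => v _; apply: sqr_ge0.
by have := IH c'; rewrite -/T -/S; nra.
Qed.

(** The first moment is recovered from the second and fourth: z is bounded below by a combination of
    z^2 and z^4 that touches it at z = 2 t. The average of this combination is at least 3/4 t - 3/16
    t = 9/16 t, whence the factor 2. *)
Lemma khintchine_avg (R : realType) n (V : finType) (c : 'I_n -> V -> R) :
  Num.sqrt (\sum_k \sum_v c k v ^+ 2) <=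
  2 * avg (fun e => Num.sqrt (\sum_v signsum c e v ^+ 2)).
Proof.
set T := \sum_k _; set t := Num.sqrt T.
have T0 : 0 <= T by do 2![apply: sumr_ge0 => ? _]; apply: sqr_ge0.
have S0 e : 0 <= \sum_v signsum c e v ^+ 2 by apply: sumr_ge0 => ? _; apply: sqr_ge0.
have : 0 <= t by apply: sqrtr_ge0.
rewrite le_eqVlt => /predU1P[<-|t0].
  rewrite mulr_ge0 // -[X in X <= _](@avg_cst R n); apply: ler_avg => e; exact: sqrtr_ge0.
have TE : T = t ^+ 2 by rewrite sqr_sqrtr.
(* [x^3 - 12 x + 16 = (x - 2)^2 (x + 4)], applied to [x = sqrt Z / t] *)
have key : avg (fun e => 3 / (4 * t) * (\sum_v signsum c e v ^+ 2) +
    - (16 * t ^+ 3)^-1 * (\sum_v signsum c e v ^+ 2) ^+ 2) <=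
    avg (fun e => Num.sqrt (\sum_v signsum c e v ^+ 2)).
  apply: ler_avg => e; set Z := \sum_v _; set z := Num.sqrt Z.
  have z0 : 0 <= z by apply: sqrtr_ge0.
  have -> : Z = z ^+ 2 by rewrite sqr_sqrtr // S0.
  rewrite -subr_ge0.
  have -> : z - (3 / (4 * t) * z ^+ 2 + - (16 * t ^+ 3)^-1 * (z ^+ 2) ^+ 2) =
    z * ((z - 2 * t) ^+ 2 * (z + 4 * t)) / (16 * t ^+ 3).
    by field; rewrite gt_eqF.
  have t0' := ltW t0.
  by rewrite divr_ge0 // mulr_ge0 ?exprn_ge0 // mulr_ge0 ?sqr_ge0 // addr_ge0 // mulr_ge0.
rewrite avgD !avgZ avg_signsum_sqr -/T in key.
have h4 := avg_signsum_pow4 c; rewrite -/T in h4.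
have i0 : 0 <= (16 * t ^+ 3)^-1 by rewrite invr_ge0 mulr_ge0 // exprn_ge0 // ltW.
have h5 := ler_wpM2l i0 h4.
have e1 : 3 / (4 * t) * T = 3 / 4 * t by rewrite TE; field; rewrite gt_eqF.
have e2 : (16 * t ^+ 3)^-1 * (3 * T ^+ 2) = 3 / 16 * t by rewrite TE; field; rewrite gt_eqF.
rewrite e1 in key; rewrite e2 in h5; lra.
Qed.

(** The average is taken of the whole sum over [p], so that a single choice of signs serves all [p]
    at once. *)
Lemma khintchine_l1 (R : realType) n (P V : finType) (c : 'I_n -> P -> V -> R) :
  exists e : {ffun 'I_n -> bool},
  \sum_p Num.sqrt (\sum_k \sum_v c k p v ^+ 2) <=
  2 * \sum_p Num.sqrt (\sum_v (\sum_k (-1) ^+ e k * c k p v) ^+ 2).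
Proof.
have [e he] := le_avg_ex (fun e : {ffun 'I_n -> bool} =>
  \sum_p Num.sqrt (\sum_v (signsum (fun k => c k p) e v) ^+ 2)).
exists e; apply: le_trans (ler_wpM2l _ he) => //.
rewrite avg_sum mulr_sumr; apply: ler_sum => p _; exact: khintchine_avg.
Qed.

(** Induction on [M]: the last coordinates are treated with values in the larger Euclidean space
    indexed by ['I_N * V], then the first one by [khintchine_l1]. Each coordinate costs a factor
    2. *)
Lemma khintchine_chaos (R : realType) M N (P V : finType)
    (c : {ffun 'I_M -> 'I_N} -> P -> V -> R) :
  exists e : 'I_M -> 'I_N -> bool,
  \sum_p Num.sqrt (\sum_f \sum_v c f p v ^+ 2) <=
  2 ^+ M * \sum_p Num.sqrt (\sum_v (\sum_(f : {ffun 'I_M -> 'I_N}) (\prod_k (-1) ^+ e k (f k)) * c f p v) ^+ 2).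
Proof.
elim: M V c => [|M IH] V c.
  exists (fun _ _ => true); rewrite expr0 mul1r; apply: ler_sum => p _.
  pose f0 : {ffun 'I_0 -> 'I_N} := finfun (fun k : 'I_0 => match notF (ltn_ord k) with end).
  rewrite (big_ffun0 _ f0) ler_sqrt; last by apply: sumr_ge0 => ? _; apply: sqr_ge0.
  by apply: ler_sum => v _; rewrite (big_ffun0 _ f0) big_ord0 mul1r.
have [e' he'] := IH _ (fun g p (av : 'I_N * V) => c (fcons av.1 g) p av.2).
have [e he] := khintchine_l1 (fun a p v =>
  \sum_(g : {ffun 'I_M -> 'I_N}) (\prod_k (-1) ^+ e' k (g k)) * c (fcons a g) p v).
exists (fun k => oapp e' e (unlift ord0 k)).
have E1 p : \sum_f \sum_v c f p v ^+ 2 =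
    \sum_g \sum_(av : 'I_N * V) c (fcons av.1 g) p av.2 ^+ 2.
  rewrite big_fcons exchange_big; apply: eq_bigr => g _.
  by rewrite pair_big.
under eq_bigr do rewrite E1.
apply: le_trans he' _; rewrite exprSr -mulrA ler_wpM2l ?exprn_ge0 //.
apply: le_trans (le_trans he _).
  rewrite le_eqVlt; apply/orP; left; apply/eqP; apply: eq_bigr => p _.
  by rewrite pair_big.
rewrite ler_wpM2l // le_eqVlt; apply/orP; left; apply/eqP; apply: eq_bigr => p _.
congr Num.sqrt; apply: eq_bigr => v _; congr (_ ^+ 2).
rewrite big_fcons; apply: eq_bigr => a _; rewrite mulr_sumr; apply: eq_bigr => g _.
rewrite big_ord_recl fcons0 unlift_none /= mulrA; congr (_ * _ * _).
by apply: eq_bigr => k _; rewrite fconsS liftK.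
Qed.

(** * The Hardy-Littlewood step *)

(* Weighted by its own marginals, a probability [mu] turns the mixed
   [l_1(l_2)] bounds for every coordinate into a single inequality. *)
Lemma marginal_inequality (R : realType) (F I J : finType) (pi : J -> F -> I)
    (b : F -> R) (U t : J -> R) (B : R) (mu : F -> R) :
  (forall f, 0 <= b f) ->
  (forall w : J -> I -> R, (forall k i, 0 <= w k i) ->
     (forall k, \sum_i w k i <= 1) -> forall k,
     \sum_i Num.sqrt (\sum_(f | pi k f == i)
       (b f * \prod_l w l (pi l f) `^ U l) ^+ 2) <= B) ->
  (forall f, 0 <= mu f) -> \sum_f mu f <= 1 ->
  (forall k, 0 <= t k) -> \sum_k t k = 1 ->
  \sum_f Num.sqrt (mu f) * b f *
    \prod_k (\sum_(f' | pi k f' == pi k f) mu f') `^ (U k - t k / 2) <= B.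
Proof.
move=> b0 H mu0 mu1 t0 t1.
pose w k i := \sum_(f | pi k f == i) mu f.
have w0 k i : 0 <= w k i by apply: sumr_ge0.
have w1 k : \sum_i w k i <= 1.
  by apply: le_trans mu1; rewrite [leRHS](partition_big (pi k) xpredT).
pose X f := b f * \prod_l w l (pi l f) `^ U l.
have X0 f : 0 <= X f by rewrite mulr_ge0 // prodr_ge0 // => l _; rewrite powR_ge0.
(* The product of the w_k^(- t_k / 2) is a weighted geometric mean of the 1 / sqrt w_k. Passing to
   the arithmetic mean leaves one marginal in each denominator, to be matched with the hypothesis
   for that coordinate. *)
apply: (@le_trans _ _ (\sum_f \sum_k t k * (Num.sqrt (mu f) * X f / Num.sqrt (w k (pi k f))))).
  apply: ler_sum => f _; rewrite -/(w _ _).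
  have := mu0 f; rewrite le_eqVlt => /predU1P[muf|muf].
    by rewrite -muf sqrtr0 !mul0r big1 // => k _; rewrite !mul0r mulr0.
  have wf k : 0 < w k (pi k f).
    by rewrite /w (bigD1 f) //= ltr_pwDl // sumr_ge0.
  have -> : \prod_k w k (pi k f) `^ (U k - t k / 2) =
      \prod_k w k (pi k f) `^ U k * \prod_k (Num.sqrt (w k (pi k f)))^-1 `^ t k.
    rewrite -big_split /=; apply: eq_bigr => k _.
    rewrite powRB; last by apply/implyP => _; rewrite gt_eqF.
    congr (_ * _); rewrite -powR12_sqrt // -!powRN -powRrM.
    by congr powR; field.
  under [leRHS]eq_bigr => k _ do rewrite mulrCA.
  rewrite -mulr_sumr !mulrA -/(X f) ler_wpM2l ?mulr_ge0 ?sqrtr_ge0 //.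
    by rewrite prodr_ge0 // => k _; rewrite powR_ge0.
  by apply: weighted_AMGM => // k; rewrite invr_ge0 sqrtr_ge0.
rewrite exchange_big /=.
suff HB k : \sum_f (Num.sqrt (mu f) * X f / Num.sqrt (w k (pi k f))) <= B.
  under eq_bigr do rewrite -mulr_sumr.
  rewrite -[leRHS]mul1r -t1 mulr_suml; apply: ler_sum => k _.
  by rewrite ler_wpM2l.
apply: le_trans (H w w0 w1 k); rewrite (partition_big (pi k) xpredT) //=.
apply: ler_sum => i _.
under eq_bigr => f /eqP -> do idtac.
rewrite -mulr_suml.
(* On a fibre of [pi k] the factor sqrt mu contributes exactly sqrt (w k i), which cancels the
   denominator. *)
have cs := cauchy_schwarz_sum (fun f => pi k f == i) (fun f => sqrtr_ge0 (mu f)) X0.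
have E : \sum_(f | pi k f == i) Num.sqrt (mu f) ^+ 2 = w k i.
  by apply: eq_bigr => f _; rewrite sqr_sqrtr.
rewrite E in cs.
have := sqrtr_ge0 (w k i); rewrite le_eqVlt => /predU1P[<-|wp].
  by rewrite invr0 mulr0 sqrtr_ge0.
by rewrite ler_pdivrMr // mulrC.
Qed.

(** [khintchine_chaos] with the value of coordinate [k] as outer index leaves a sum of absolute
    values |Y p|. All terms of Y p share f k = p, so the sign of Y p can be absorbed into the k-th
    family of signs at p. *)
Lemma mixed_of_signs (R : realType) M N (c : {ffun 'I_M -> 'I_N} -> R) (B : R) :
  (forall e : 'I_M -> 'I_N -> bool, \sum_(f : {ffun 'I_M -> 'I_N}) (\prod_k (-1) ^+ e k (f k)) * c f <= B) ->
  forall k, \sum_i Num.sqrt (\sum_(f : {ffun 'I_M -> 'I_N} | f k == i) c f ^+ 2) <= 2 ^+ M * B.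
Proof.
move=> H k.
have [e he] := khintchine_chaos (fun (f : {ffun 'I_M -> 'I_N}) (p : 'I_N) (_ : unit) =>
  if f k == p then c f else 0).
have E i : \sum_(f : {ffun 'I_M -> 'I_N} | f k == i) c f ^+ 2 =
    \sum_(f : {ffun 'I_M -> 'I_N}) \sum_(v : unit) (if f k == i then c f else 0) ^+ 2.
  rewrite big_mkcond; apply: eq_bigr => f _; rewrite big_const card_unit /= addr0.
  by case: ifP => // _; rewrite expr0n.
under eq_bigr do rewrite E.
apply: le_trans he _; rewrite ler_wpM2l ?exprn_ge0 //.
pose Y p := \sum_(f : {ffun 'I_M -> 'I_N}) (\prod_l (-1) ^+ e l (f l)) * (if f k == p then c f else 0).
have -> : \sum_p Num.sqrt (\sum_(v : unit) Y p ^+ 2) = \sum_p (-1) ^+ (Y p < 0)%R * Y p.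
  apply: eq_bigr => p _; rewrite big_const card_unit /= addr0 sqrtr_sqr.
  by case: ltrP => h /=; [rewrite expr1 mulN1r ltr0_norm|rewrite expr0 mul1r ger0_norm].
apply: le_trans (H (fun l i => e l i (+) ((l == k) && (Y i < 0)%R))).
rewrite le_eqVlt; apply/orP; left; apply/eqP.
under eq_bigr do rewrite {2}/Y mulr_sumr.
rewrite exchange_big /=; apply: eq_bigr => f _.
rewrite (bigD1 (f k)) //= eqxx [X in _ + X]big1 ?addr0; last first.
  by move=> p /negbTE pf; rewrite eq_sym pf !mulr0.
rewrite mulrA; congr (_ * _).
under [RHS]eq_bigr do rewrite signr_addb.
rewrite big_split /= mulrC; congr (_ * _).
rewrite (bigD1 k) //= eqxx /= big1 ?mulr1 // => l /negbTE ->.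
by rewrite expr0.
Qed.

Definition ucons (R : Type) m (a : R) (u : 'I_m -> R) (k : 'I_m.+1) : R :=
  oapp u a (unlift ord0 k).

Lemma ucons0 (R : Type) m (a : R) (u : 'I_m -> R) : ucons a u ord0 = a.
Proof. by rewrite /ucons unlift_none. Qed.

Lemma uconsS (R : Type) m (a : R) (u : 'I_m -> R) k : ucons a u (lift ord0 k) = u k.
Proof. by rewrite /ucons liftK. Qed.

Lemma mixed_to_lp (R : realType) m N (b : {ffun 'I_m.+1 -> 'I_N} -> R)
    (u : 'I_m -> R) (h r B : R) :
  (forall f, 0 <= b f) -> (forall j, 0 <= u j) -> 0 < \sum_j u j ->
  1 / 2 <= h -> h <= 1 -> 2 <= r -> r^-1 = h - \sum_j u j -> 0 <= B ->
  (forall w : 'I_m.+1 -> 'I_N -> R, (forall k i, 0 <= w k i) ->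
     (forall k, \sum_i w k i <= 1) -> forall k,
     \sum_i Num.sqrt (\sum_(f : {ffun 'I_m.+1 -> 'I_N} | f k == i)
       (b f * \prod_l w l (f l) `^ ucons (1 - h) u l) ^+ 2) <= B) ->
  \sum_g (\sum_a b (fcons a g) ^+ 2) `^ (r / 2) <= B `^ r.
Proof.
move=> b0 u0; set x := \sum_j u j => x0 h2 h1 r2 rE B0 H.
have r0 : 0 < r by lra.
pose be g := \sum_a b (fcons a g) ^+ 2.
have be0 g : 0 <= be g by apply: sumr_ge0 => a _; apply: sqr_ge0.
set S := \sum_g _.
have : 0 <= S by apply: sumr_ge0 => g _; apply: powR_ge0.
rewrite le_eqVlt => /predU1P[<-|S0]; first exact: powR_ge0.
pose tl (f : {ffun 'I_m.+1 -> 'I_N}) : {ffun 'I_m -> 'I_N} := [ffun j => f (lift ord0 j)].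
have tlE a g : tl (fcons a g) = g by apply/ffunP => j; rewrite ffunE fconsS.
pose mu f := b f ^+ 2 * be (tl f) `^ (r / 2 - 1) / S.
have mu0 f : 0 <= mu f by rewrite divr_ge0 ?(ltW S0) // mulr_ge0 ?sqr_ge0 ?powR_ge0.
have mug g : \sum_a mu (fcons a g) = be g `^ (r / 2) / S.
  rewrite /mu -mulr_suml; congr (_ / _).
  under eq_bigr do rewrite tlE.
  rewrite -mulr_suml -/(be g) mulr_powRB1 //; lra.
have mu1 : \sum_f mu f = 1.
  rewrite big_fcons exchange_big /=.
  under eq_bigr do rewrite mug.
  by rewrite -mulr_suml divff // gt_eqF.
(* Here t_0 / 2 equals the weight exponent 1 - h of coordinate 0. The shares are nonnegative because
   1/2 <= h <= 1. *)
pose t := ucons (2 - 2 * h) (fun j => (2 * h - 1) * u j / x).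
have t0 k : 0 <= t k.
  rewrite /t /ucons; case: unlift => [j|] /=; last lra.
  by rewrite divr_ge0 ?(ltW x0) // mulr_ge0 // ; lra.
have t1 : \sum_k t k = 1.
  rewrite /t big_ord_recl ucons0.
  under eq_bigr do rewrite uconsS.
  rewrite -mulr_suml -mulr_sumr -/x mulfK ?gt_eqF //; lra.
have := @marginal_inequality R _ _ _ (fun k (f : {ffun 'I_m.+1 -> 'I_N}) => f k) b (ucons (1 - h) u) t B mu
  b0 H mu0 _ t0 t1.
rewrite mu1 lexx => /(_ isT) core.
have Sr : S `^ r^-1 <= B.
  apply: le_trans core.
  have -> : S `^ r^-1 = \sum_g be g `^ (r / 2) * S `^ (r^-1 - 1).
    rewrite -mulr_suml -/S mulrC -[X in _ * X](powRr1 (ltW S0)) -powRD.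
      by congr powR; lra.
    by apply/implyP => _; rewrite gt_eqF.
  rewrite big_fcons exchange_big /=; apply: ler_sum => g _.
  have -> : be g `^ (r / 2) = \sum_a b (fcons a g) ^+ 2 * be g `^ (r / 2 - 1).
    rewrite -mulr_suml -/(be g) mulr_powRB1 //; lra.
  rewrite mulr_suml; apply: ler_sum => a _.
  have := b0 (fcons a g); rewrite le_eqVlt => /predU1P[<-|ba].
    by rewrite expr0n !mul0r mulr0 mul0r.
  have bep : 0 < be g.
    rewrite /be (bigD1 a) //= ltr_pwDl ?exprn_gt0 // sumr_ge0 // => ? _; exact: sqr_ge0.
  (* [nu] is the total mass of the [fcons a g] over all a. It bounds from below the marginal of
     every coordinate other than 0, and the exponents of these marginals add up to 1/2 - 1/r. *)
  set nu := be g `^ (r / 2) / S.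
  have nu0 : 0 < nu by rewrite divr_gt0 // powR_gt0.
  have -> : Num.sqrt (mu (fcons a g)) =
      b (fcons a g) * be g `^ ((r / 2 - 1) / 2) * S `^ (- (1 / 2)).
    rewrite /mu tlE sqrt_powR ?mu0 //; last by have := mu0 (fcons a g); rewrite /mu tlE.
    rewrite -[in X in X `^ _](powR_inv1 (ltW S0)) !powRM ?mulr_ge0 ?powR_ge0 ?sqr_ge0 //.
    rewrite -(sqrt_powR (ltW ba)) -expr2 sqr_sqrtr ?(ltW ba) //.
    rewrite -!powRrM.
    by congr (_ * _ `^ _ * _ `^ _); lra.
  apply: (@le_trans _ _ (b (fcons a g) * be g `^ ((r / 2 - 1) / 2) * S `^ (- (1 / 2))
      * b (fcons a g) * nu `^ (1 / 2 - r^-1))).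
    rewrite /nu powR_div ?powR_ge0 ?(ltW S0) // -powRrM -powRN.
    have -> : r / 2 * (1 / 2 - r^-1) = (r / 2 - 1) / 2.
      by field; rewrite gt_eqF.
    set P := be g `^ ((r / 2 - 1) / 2).
    have -> : be g `^ (r / 2 - 1) = P * P.
      by rewrite -powRD ?(gt_eqF bep) ?(gt_eqF S0) ?implybT //; congr powR; lra.
    have -> : S `^ (r^-1 - 1) = S `^ (- (1 / 2)) * S `^ (- (1 / 2 - r^-1)).
      by rewrite -powRD ?(gt_eqF bep) ?(gt_eqF S0) ?implybT //; congr powR; lra.
    by rewrite le_eqVlt; apply/orP; left; apply/eqP; ring.
  rewrite ler_wpM2l ?mulr_ge0 ?powR_ge0 ?(ltW ba) //.
  rewrite big_ord_recl ucons0 /t ucons0.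
  have -> : 1 - h - (2 - 2 * h) / 2 = 0 by lra.
  rewrite powRr0 [leRHS]mul1r.
  have -> : 1 / 2 - r^-1 = \sum_j u j / x * (1 / 2 - r^-1).
    by rewrite -mulr_suml -mulr_suml -/x divff ?gt_eqF // [RHS]mul1r.
  rewrite -prod_powR //; apply: ler_prod => j _; rewrite powR_ge0 /= !uconsS.
  have -> : u j - (2 * h - 1) * u j / x / 2 = u j / x * (1 / 2 - r^-1).
    by rewrite rE; field; rewrite gt_eqF.
  apply: ge0_ler_powR; rewrite ?nnegrE ?(ltW nu0) //.
  - rewrite mulr_ge0 ?divr_ge0 ?(ltW x0) //.
    have : r^-1 <= 2^-1 by rewrite lef_pV2 ?posrE.
    lra.
  - exact: sumr_ge0.
  rewrite /nu -mug fconsS [leRHS]big_mkcond [leRHS]big_fcons; apply: ler_sum => a' _.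
  rewrite (bigD1 g) //= fconsS eqxx lerDl sumr_ge0 // => g' _.
  by case: ifP.
rewrite -(powRr1 (ltW S0)) -(mulVf (lt0r_neq0 r0)) powRrM.
by apply: ge0_ler_powR; rewrite ?nnegrE ?(ltW r0) ?powR_ge0.
Qed.

(** * Scalars and the norms of X_p *)

Section Scalars.
Context (R : realType) (k : scalar_kind).
Local Notation K := (Defs.scalar R k).
Local Notation modulus := (@Defs.modulus R k).

Lemma modulus0 : modulus 0 = 0.
Proof. by case: k => /=; [exact: normr0|exact: ComplexField.Normc.normc0]. Qed.

Lemma modulus1 : modulus 1 = 1.
Proof. by case: k => /=; [exact: normr1|exact: ComplexField.Normc.normc1]. Qed.

Lemma modulusM (x y : K) : modulus (x * y) = modulus x * modulus y.
Proof. by move: x y; case: k => /= x y; [exact: normrM|exact: ComplexField.Normc.normcM]. Qed.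

Lemma modulus_ge0 (x : K) : 0 <= modulus x.
Proof. by move: x; case: k => /= [x|[a b]]; [exact: normr_ge0|exact: sqrtr_ge0]. Qed.

Lemma le_modulusD (x y : K) : modulus (x + y) <= modulus x + modulus y.
Proof. by move: x y; case: k => /= x y; [exact: ler_normD|exact: le_normcD]. Qed.

Lemma le_modulus_sum (I : Type) (r : seq I) (P : pred I) (F : I -> K) :
  modulus (\sum_(i <- r | P i) F i) <= \sum_(i <- r | P i) modulus (F i).
Proof.
elim/big_rec2 : _ => [|i y z _ h]; first by rewrite modulus0.
by apply: le_trans (le_modulusD _ _) _; rewrite lerD2l.
Qed.

Lemma modulus_prod (I : Type) (r : seq I) (P : pred I) (F : I -> K) :
  modulus (\prod_(i <- r | P i) F i) = \prod_(i <- r | P i) modulus (F i).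
Proof. by apply: (big_morph _ modulusM modulus1). Qed.

Definition of_real : R -> K :=
  match k return R -> Defs.scalar R k with
  | RealScalars => fun x => x | ComplexScalars => fun x => (x%:C)%C end.

Definition re_part : K -> R :=
  match k return Defs.scalar R k -> R with
  | RealScalars => fun x => x | ComplexScalars => fun x => complex.Re x end.

(** With imaginary part 0 over the reals, both scalar fields go through the same argument on the
    real and the imaginary parts. *)
Definition im_part : K -> R :=
  match k return Defs.scalar R k -> R with
  | RealScalars => fun=> 0 | ComplexScalars => fun x => complex.Im x end.

Lemma modulus_of_real (a : R) : modulus (of_real a) = `|a|.
Proof. by rewrite /of_real; case: k => //=; rewrite expr0n addr0 sqrtr_sqr. Qed.

Lemma of_realM (a b : R) : of_real (a * b) = of_real a * of_real b.
Proof. by rewrite /of_real; case: k => //=; rewrite rmorphM. Qed.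

Lemma of_real_prod (I : finType) (F : I -> R) :
  of_real (\prod_i F i) = \prod_i of_real (F i).
Proof.
apply: (big_morph _ of_realM).
by rewrite /of_real; case: k.
Qed.

Lemma re_part_sum (I : finType) (c : I -> R) (z : I -> K) :
  re_part (\sum_i of_real (c i) * z i) = \sum_i c i * re_part (z i).
Proof.
rewrite /re_part /of_real; move: z; case: k => // z.
apply: (big_ind2 (fun (x : R[i]) y => complex.Re x = y)) => //=.
  by move=> [a b] y [c' d] z' /= <- <-.
by move=> i _; case: (z i) => a b /=; rewrite mul0r subr0.
Qed.

Lemma im_part_sum (I : finType) (c : I -> R) (z : I -> K) :
  im_part (\sum_i of_real (c i) * z i) = \sum_i c i * im_part (z i).
Proof.
rewrite /im_part /of_real; move: z; case: k => z.
  by rewrite big1 // => i _; rewrite mulr0.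
apply: (big_ind2 (fun (x : R[i]) y => complex.Im x = y)) => //=.
  by move=> [a b] y [c' d] z' /= <- <-.
by move=> i _; case: (z i) => a b /=; rewrite mul0r addr0.
Qed.

Lemma modulus_sqr (z : K) : modulus z ^+ 2 = re_part z ^+ 2 + im_part z ^+ 2.
Proof.
rewrite /re_part /im_part; move: z; case: k => [x|[a b]] /=.
  by rewrite expr0n addr0 real_normK ?num_real.
by rewrite sqr_sqrtr // addr_ge0 // sqr_ge0.
Qed.

Lemma re_part_le (z : K) : `|re_part z| <= modulus z.
Proof.
rewrite -(@ler_pXn2r _ 2) ?nnegrE ?normr_ge0 ?modulus_ge0 //.
by rewrite modulus_sqr real_normK ?num_real // lerDl sqr_ge0.
Qed.

Lemma im_part_le (z : K) : `|im_part z| <= modulus z.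
Proof.
rewrite -(@ler_pXn2r _ 2) ?nnegrE ?normr_ge0 ?modulus_ge0 //.
by rewrite modulus_sqr real_normK ?num_real // lerDr sqr_ge0.
Qed.

Lemma lp_normE (p : R) (x : nat -> K) : 0 < p ->
  lp_norm p%:E x = ((\sum_(n <oo) (modulus (x n) `^ p)%:E) `^ p^-1)%E.
Proof.
move=> p0; rewrite /lp_norm Lnorm_counting //; congr (_ `^ _)%E.
by apply: eq_eseriesr => n _; rewrite gee0_abs ?lee_fin ?modulus_ge0 // poweR_EFin.
Qed.

Lemma lp_norm_le (p B : R) (x : nat -> K) : 0 < p -> 0 <= B ->
  (forall N, \sum_(n < N) modulus (x n) `^ p <= B `^ p) -> (lp_norm p%:E x <= B%:E)%E.
Proof.
move=> p0 B0 h; rewrite lp_normE //.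
have S0 n : (0 <= (modulus (x n) `^ p)%:E)%E by rewrite lee_fin powR_ge0.
have -> : B%:E = ((B `^ p)%:E `^ p^-1)%E.
  by rewrite poweR_EFin -powRrM divff ?gt_eqF // powRr1.
apply: gt0_ler_poweR; rewrite ?in_itv /= ?leey ?andbT.
- by rewrite invr_ge0 ltW.
- exact: nneseries_ge0.
- by rewrite lee_fin powR_ge0.
apply: lime_le; first exact: is_cvg_nneseries.
by apply: nearW => N; rewrite sumEFin big_mkord lee_fin.
Qed.

Lemma lp_norm_ge (p : R) (x : nat -> K) N : 0 < p ->
  (((\sum_(n < N) modulus (x n) `^ p) `^ p^-1)%:E <= lp_norm p%:E x)%E.
Proof.
move=> p0; rewrite lp_normE // -poweR_EFin.
have S0 n : (0 <= (modulus (x n) `^ p)%:E)%E by rewrite lee_fin powR_ge0.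
have E : (\sum_(n < N) modulus (x n) `^ p)%:E =
    (\sum_(0 <= n < N) (modulus (x n) `^ p)%:E)%E by rewrite sumEFin big_mkord.
apply: gt0_ler_poweR; rewrite ?in_itv /= ?leey ?andbT.
- by rewrite invr_ge0 ltW.
- by rewrite lee_fin sumr_ge0 // => n _; rewrite powR_ge0.
- exact: nneseries_ge0.
by rewrite E; apply: nneseries_lim_ge.
Qed.

Lemma lp_norm_psum_le (p B : R) (x : nat -> K) N : 0 < p -> 0 <= B ->
  (lp_norm p%:E x <= B%:E)%E -> \sum_(n < N) modulus (x n) `^ p <= B `^ p.
Proof.
move=> p0 B0 /(le_trans (lp_norm_ge x N p0)); rewrite lee_fin => h.
have S0 : 0 <= \sum_(n < N) modulus (x n) `^ p by apply: sumr_ge0 => n _; exact: powR_ge0.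
rewrite -(powRr1 S0) -(mulVf (lt0r_neq0 p0)) powRrM.
by apply: ge0_ler_powR; rewrite ?nnegrE ?powR_ge0 // ltW.
Qed.

Lemma counting_gt0 : (0 < @counting nat R [set: nat])%E.
Proof.
by rewrite /counting; case: ifPn => // /asboolP /infinite_nat.
Qed.

(** Singletons have counting measure 1, so the exceptional null set of the essential supremum
    contains no index. *)
Lemma lp_norm_infty_ge (x : nat -> K) n : ((modulus (x n))%:E <= lp_norm +oo x)%E.
Proof.
rewrite /lp_norm unlock counting_gt0.
have [A [mA A0 hA]] := ess_sup_ge (@counting nat R) (abse \o (fun n => (modulus (x n))%:E)).
have [An|An] := pselect (A n).
  have : (@counting nat R [set n] <= @counting nat R A)%E.
    by apply: le_measure => [||_ -> //]; apply/mem_set.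
  by rewrite A0 /counting asboolT // fset_set1 cardfs1 lee_fin ler10.
by have := contra_not (@hA n) An => /contrapT; rewrite /= ger0_norm ?modulus_ge0.
Qed.

Lemma lp_norm_infty_le (B : R) (x : nat -> K) :
  (forall n, modulus (x n) <= B) -> (lp_norm +oo x <= B%:E)%E.
Proof.
move=> h; rewrite /lp_norm unlock counting_gt0; apply/ess_supP/nearW => n /=.
by rewrite lee_fin ger0_norm ?modulus_ge0.
Qed.
End Scalars.

(** * Finitely supported sequences and multilinear expansion *)

Lemma sum_trunc_le (R : realType) (a : nat -> R) N M :
  (forall n, 0 <= a n) -> (forall n, (N <= n)%N -> a n = 0) ->
  \sum_(n < M) a n <= \sum_(n < N) a n.
Proof.
move=> a0 aN; rewrite -!(big_mkord xpredT a).
have [MN|/ltnW NM] := leqP M N.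
  by rewrite (big_cat_nat (leq0n M) MN) /= lerDl sumr_ge0.
rewrite (big_cat_nat (leq0n N) NM) /= [X in _ + X]big_nat_cond [X in _ + X]big1 ?addr0 //.
by move=> n /andP[/andP[/aN]].
Qed.

Section Sequences.
Context (R : realType) (k : scalar_kind).
Local Notation K := (Defs.scalar R k).
Local Notation modulus := (@Defs.modulus R k).
Implicit Types (p : \bar R) (x : nat -> K).

Lemma one_le_cases p : (1 <= p)%E -> (exists2 r : R, p = r%:E & 1 <= r) \/ p = +oo%E.
Proof. by case: p => [r|_|//]; [rewrite lee_fin => r1; left; exists r|right]. Qed.

Lemma lp_norm_coord p x n : (1 <= p)%E -> ((modulus (x n))%:E <= lp_norm p x)%E.
Proof.
move=> /one_le_cases[[r -> r1]|->]; last exact: lp_norm_infty_ge.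
have r0 : 0 < r by lra.
apply: le_trans (lp_norm_ge x n.+1 r0); rewrite lee_fin.
rewrite -[leLHS](powRr1 (modulus_ge0 _)) -(divff (lt0r_neq0 r0)) powRrM.
apply: ge0_ler_powR; rewrite ?nnegrE ?powR_ge0 ?invr_ge0 ?(ltW r0) //.
  by apply: sumr_ge0 => i _; rewrite powR_ge0.
by rewrite big_ord_recr /= lerDr sumr_ge0 // => i _; rewrite powR_ge0.
Qed.

Lemma lp_norm_weight_le1 p x (w : nat -> R) N : (1 <= p)%E ->
  (forall n, 0 <= w n) -> \sum_(n < N) w n <= 1 ->
  (forall n, modulus (x n) <= w n `^ fine p^-1) ->
  (forall n, (N <= n)%N -> x n = 0) -> (lp_norm p x <= 1)%E.
Proof.
move=> /one_le_cases[[r -> r1]|->] w0 w1 xw xN; last first.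
  by apply: lp_norm_infty_le => n; rewrite (le_trans (xw n)) // powRr0.
have r0 : 0 < r by lra.
apply: (@lp_norm_le _ _ r 1) => // M; rewrite powR1.
apply: (le_trans (@sum_trunc_le _ (fun n => modulus (x n) `^ r) N M _ _)).
- by move=> n; exact: powR_ge0.
- by move=> n /xN ->; rewrite modulus0 powR0 // gt_eqF.
apply: le_trans w1; apply: ler_sum => n _.
rewrite -[leRHS](powRr1 (w0 _)) -(mulVf (lt0r_neq0 r0)) powRrM.
apply: ge0_ler_powR; rewrite ?nnegrE ?powR_ge0 ?modulus_ge0 ?(ltW r0) //.
by have := xw n; rewrite fine_invr.
Qed.

Lemma lp_norm_le1_weight p x : (1 <= p)%E -> (lp_norm p x <= 1)%E ->
  exists w : nat -> R, [/\ forall n, 0 <= w n, forall N, \sum_(n < N) w n <= 1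
    & forall n, modulus (x n) <= w n `^ fine p^-1].
Proof.
move=> /one_le_cases[[r -> r1]|->] xp; last first.
  exists (fun=> 0); split => // [N|n]; first by rewrite big1.
  by rewrite powRr0 -lee_fin; apply: le_trans xp; exact: lp_norm_infty_ge.
have r0 : 0 < r by lra.
exists (fun n => modulus (x n) `^ r); split => [n|N|n]; first exact: powR_ge0.
  by apply: le_trans (lp_norm_psum_le N r0 _ xp) _; rewrite ?powR1.
by rewrite fine_invr -powRrM divff ?gt_eqF // powRr1 ?modulus_ge0.
Qed.

Definition finite_supp x : Prop := exists N, forall n, (N <= n)%N -> x n = 0.

Lemma finite_supp_Xspace p x : (1 <= p)%E -> finite_supp x -> Xspace p x.
Proof.
move=> p1 [N xN]; rewrite /Xspace; case: ifPn => [_|].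
  apply: cvg_near_cst; exists N => // n /= Nn.
  by rewrite xN // modulus0.
case/one_le_cases: p1 => [[r -> r1] _|->]; last by rewrite eqxx.
have r0 : 0 < r by lra.
set S := \sum_(n < N) modulus (x n) `^ r.
have S0 : 0 <= S by apply: sumr_ge0 => n _; exact: powR_ge0.
apply: (@le_lt_trans _ _ (S `^ r^-1)%:E); last exact: ltry.
apply: lp_norm_le; rewrite ?powR_ge0 // => M.
rewrite -powRrM mulVf ?gt_eqF // powRr1 //; apply: (@sum_trunc_le _ (fun n => modulus (x n) `^ r)) => n.
  exact: powR_ge0.
by move=> /xN ->; rewrite modulus0 powR0 // gt_eqF.
Qed.

Lemma finite_supp_unit i : finite_supp (unit_seq R k i).
Proof. by exists i.+1 => n ni; rewrite /unit_seq gtn_eqF. Qed.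

Lemma finite_supp0 : finite_supp (fun=> 0).
Proof. by exists 0%N. Qed.

Definition trunc_seq N x : nat -> K := fun n => if (n < N)%N then x n else 0.

Lemma finite_supp_trunc N x : finite_supp (trunc_seq N x).
Proof. by exists N => n; rewrite /trunc_seq leqNgt => /negbTE ->. Qed.

(** Linearity on finitely supported sequences only: these lie in every [Xspace p], and the property
    is inherited when one argument is frozen at a unit vector, which drives the induction in
    [lin_coord_expand]. *)
Definition lin_coord m (Phi : ('I_m -> nat -> K) -> K) : Prop :=
  forall (x : 'I_m -> nat -> K) (j : 'I_m) (a : K) (u v : nat -> K), (forall i, finite_supp (x i)) -> finite_supp u -> finite_supp v ->
  Phi (@dfwith _ (fun=> nat -> K) x j (fun n => a * u n + v n)) =
  a * Phi (@dfwith _ (fun=> nat -> K) x j u) + Phi (@dfwith _ (fun=> nat -> K) x j v).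

Lemma lin_coord_trunc m (Phi : ('I_m -> nat -> K) -> K) (x : 'I_m -> nat -> K) j v N : lin_coord Phi ->
  (forall i, finite_supp (x i)) ->
  Phi (@dfwith _ (fun=> nat -> K) x j (trunc_seq N v)) =
  \sum_(a < N) v a * Phi (@dfwith _ (fun=> nat -> K) x j (unit_seq R k a)).
Proof.
move=> Phil fx; elim: N => [|N IH].
  rewrite big_ord0.
  have /= := Phil x j 1 _ _ fx finite_supp0 finite_supp0; rewrite mulr0 addr0 mul1r.
  by move/(congr1 (fun z => z - Phi (@dfwith _ (fun=> nat -> K) x j (fun=> 0)))); rewrite subrr addrK.
rewrite big_ord_recr /= -IH addrC -Phil //; [|exact: finite_supp_unit|exact: finite_supp_trunc].
congr (Phi (@dfwith _ (fun=> nat -> K) _ _ _)); apply/funext => n; rewrite /trunc_seq /unit_seq ltnS leq_eqVlt.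
case: eqVneq => [->|nN] /=; first by rewrite ltnn mulr1 addr0.
by rewrite mulr0 add0r.
Qed.

Definition vcons m (a : nat -> K) (y : 'I_m -> nat -> K) (j : 'I_m.+1) : nat -> K :=
  oapp y a (unlift ord0 j).

Lemma vcons_dfwith m a y (j : 'I_m) v :
  vcons a (@dfwith _ (fun=> nat -> K) y j v) =
  @dfwith _ (fun=> nat -> K) (vcons a y) (lift ord0 j) v.
Proof.
apply/funext => i; rewrite /vcons; case: unliftP => [i' ->|->] /=.
  have [->|ji] := eqVneq i' j; first by rewrite !dfwithin.
  rewrite !dfwithout ?(inj_eq lift_inj) 1?eq_sym //.
  by rewrite liftK.
by rewrite dfwithout ?unlift_none // neq_lift.
Qed.

Lemma lin_coord_expand m (Phi : ('I_m -> nat -> K) -> K) (x : 'I_m -> nat -> K) N : lin_coord Phi ->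
  Phi (fun j => trunc_seq N (x j)) =
  \sum_(g : {ffun 'I_m -> 'I_N}) (\prod_j x j (g j)) * Phi (fun j => unit_seq R k (g j)).
Proof.
elim: m Phi x => [|m IH] Phi x Phil.
  pose f0 : {ffun 'I_0 -> 'I_N} := finfun (fun j : 'I_0 => match notF (ltn_ord j) with end).
  rewrite (big_ffun0 _ f0) big_ord0 mul1r; congr Phi.
  by apply/funext => -[].
rewrite big_fcons.
pose x0 (j : 'I_m) : nat -> K := trunc_seq N (x (lift ord0 j)).
have -> : (fun j => trunc_seq N (x j)) =
    (* The zero sequence is a placeholder, overwritten at [ord0]. *)
    @dfwith _ (fun=> nat -> K) (vcons (fun=> 0) x0) ord0 (trunc_seq N (x ord0)).
  apply/funext => j; case: dfwithP => // i i0.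
  by rewrite /vcons; case: unliftP i0 => [i' ->|->] //=; rewrite eqxx.
rewrite lin_coord_trunc //; last first.
  by move=> i; rewrite /vcons; case: unlift => [i'|] /=; [exact: finite_supp_trunc|exact: finite_supp0].
apply: eq_bigr => a _.
have -> : @dfwith _ (fun=> nat -> K) (vcons (fun=> 0) x0) ord0 (unit_seq R k a) =
    vcons (unit_seq R k a) x0.
  apply/funext => j; case: dfwithP => [|i i0]; first by rewrite /vcons unlift_none.
  by rewrite /vcons; case: unliftP i0 => [i' ->|->] //=; rewrite eqxx.
rewrite (IH (fun y => Phi (vcons (unit_seq R k a) y)) (fun j => x (lift ord0 j))).
  rewrite mulr_sumr; apply: eq_bigr => g _; rewrite big_ord_recl fcons0 mulrA.
  congr (_ * _ * _); first by apply: eq_bigr => j _; rewrite fconsS.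
  congr Phi; apply/funext => j; rewrite /vcons; case: unliftP => [j' ->|->] /=.
    by rewrite fconsS.
  by rewrite fcons0.
move=> y j b u v fy fu fv; rewrite !vcons_dfwith Phil // => i.
by rewrite /vcons; case: unlift => [i'|] //=; exact: finite_supp_unit.
Qed.
End Sequences.

(** * The sufficient condition *)

Lemma sqrtrD_le (R : realType) (a b : R) : 0 <= a -> 0 <= b ->
  Num.sqrt (a + b) <= Num.sqrt a + Num.sqrt b.
Proof.
move=> a0 b0; rewrite -(@ler_pXn2r _ 2) ?nnegrE ?addr_ge0 ?sqrtr_ge0 //.
rewrite sqr_sqrtr ?addr_ge0 // sqrrD !sqr_sqrtr //.
have : 0 <= Num.sqrt a * Num.sqrt b by rewrite mulr_ge0 ?sqrtr_ge0.
lra.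
Qed.

(** Log-convexity of the power sums in the exponent: q = s (1 - t) + 2 t, followed by Hölder. Zero
    entries are separated because an exponent may vanish at an endpoint. *)
Lemma powR_interp (R : realType) (I : finType) (a : I -> R) (s q : R) :
  (forall i, 0 <= a i) -> 1 <= s -> s <= q -> q <= 2 -> s < 2 ->
  \sum_i a i `^ q <= (\sum_i a i `^ s) `^ (1 - (q - s) / (2 - s)) *
                     (\sum_i a i ^+ 2) `^ ((q - s) / (2 - s)).
Proof.
move=> a0 s1 sq q2 s2; set t := (q - s) / (2 - s).
have t0 : 0 <= t by rewrite divr_ge0 //; lra.
have t1 : t <= 1 by rewrite ler_pdivrMr; lra.
have sE : s * (1 - t) + 2 * t = q by rewrite /t; field; lra.
have tt : t = 1 - (1 - t) by lra.
rewrite mulrC {1}tt [leRHS]mulrC.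
have := @hoelder_sum R I xpredT (1 - t) (fun i => a i `^ s) (fun i => a i ^+ 2).
have -> : \sum_i (a i `^ s) `^ (1 - t) * (a i ^+ 2) `^ (1 - (1 - t)) = \sum_i a i `^ q.
  apply: eq_bigr => i _; rewrite -tt -powRrM.
  rewrite -(powR_mulrn 2 (a0 i)) -powRrM -sE.
  have := a0 i; rewrite le_eqVlt => /predU1P[<-|ai].
    rewrite [RHS]powR0; last by rewrite sE; apply/eqP; lra.
    have [e|e] := eqVneq (s * (1 - t)) 0; last by rewrite (powR0 e) mul0r.
    by rewrite [X in _ * X]powR0 ?mulr0 //; apply/eqP; lra.
  by rewrite powRD //; apply/implyP => _; rewrite gt_eqF.
apply; first lra; first lra.
  by move=> i; exact: powR_ge0.
by move=> i; exact: sqr_ge0.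
Qed.

Section SignForms.
Context (R : realType) (k : scalar_kind) (m : nat) (p : 'I_m -> \bar R).
Context (A : ('I_m -> nat -> Defs.scalar R k) -> nat -> Defs.scalar R k).
Local Notation K := (Defs.scalar R k).
Local Notation modulus := (@Defs.modulus R k).
Hypothesis p1 : forall j, (1 <= p j)%E.

Lemma lin_coord_multilinear n : multilinear_on p A -> lin_coord (fun x => A x n).
Proof.
move=> Al x j a u v fx fu fv; rewrite Al //; last 2 first.
- exact: finite_supp_Xspace.
- exact: finite_supp_Xspace.
by move=> i; apply: finite_supp_Xspace.
Qed.

Lemma op_norm_ge s B (x : 'I_m -> nat -> K) : (op_norm p s A <= B%:E)%E -> (forall j, finite_supp (x j)) ->
  (forall j, (lp_norm (p j) (x j) <= 1)%E) -> (lp_norm s%:E (A x) <= B%:E)%E.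
Proof.
move=> AB fx x1; apply: le_trans AB; apply: ereal_sup_ubound.
exists x => //; split => // j; exact: finite_supp_Xspace.
Qed.

(** The sum is the pairing of A(x) with a vector of the unit ball of the dual of l_s: the signed
    powers with exponent 1/p_j are admissible arguments of A, and coordinate 0 carries the conjugate
    exponent 1 - 1/s. *)
Lemma sgn_form_le s B N (e : 'I_m.+1 -> 'I_N -> bool) (w : 'I_m.+1 -> 'I_N -> R) :
  1 <= s -> 0 <= B -> multilinear_on p A -> (op_norm p s A <= B%:E)%E ->
  (forall l i, 0 <= w l i) -> (forall l, \sum_i w l i <= 1) ->
  modulus (\sum_(f : {ffun 'I_m.+1 -> 'I_N})
    of_real k (\prod_l ((-1) ^+ e l (f l) *
      w l (f l) `^ ucons (1 - s^-1) (fun j => fine (p j)^-1) l)) *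
    A (fun j => unit_seq R k (f (lift ord0 j))) (f ord0)) <= B.
Proof.
move=> s1 B0 Al AB w0 w1.
have s0 : 0 < s by lra.
pose x (j : 'I_m) n : K := if insub n is Some i then
  of_real k ((-1) ^+ e (lift ord0 j) i * w (lift ord0 j) i `^ fine (p j)^-1) else 0.
have xE j (i : 'I_N) : x j i =
    of_real k ((-1) ^+ e (lift ord0 j) i * w (lift ord0 j) i `^ fine (p j)^-1).
  by rewrite /x valK.
have xN j n : (N <= n)%N -> x j n = 0.
  by move=> Nn; rewrite /x insubF // ltnNge Nn.
have fx j : finite_supp (x j) by exists N; exact: xN.
have xT : (fun j => trunc_seq N (x j)) = x.
  apply/funext => j; apply/funext => n; rewrite /trunc_seq.
  by case: ltnP => // /xN ->.
have x1 j : (lp_norm (p j) (x j) <= 1)%E.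
  pose w' n := if insub n is Some i then w (lift ord0 j) i else 0.
  apply: (@lp_norm_weight_le1 _ _ _ _ w' N) => //.
  - by move=> n; rewrite /w'; case: insubP.
  - apply: le_trans (w1 (lift ord0 j)); apply: ler_sum => i _.
    by rewrite /w' valK.
  - move=> n; rewrite /x /w'; case: insubP => [i _ _|_]; last by rewrite modulus0 powR_ge0.
    by rewrite modulus_of_real normrM normrX normrN1 expr1n mul1r ger0_norm ?powR_ge0.
  - exact: xN.
have Ax := op_norm_ge AB fx x1.
set U := ucons _ _.
have -> : \sum_(f : {ffun 'I_m.+1 -> 'I_N})
    of_real k (\prod_l ((-1) ^+ e l (f l) * w l (f l) `^ U l)) *
    A (fun j => unit_seq R k (f (lift ord0 j))) (f ord0) =
    \sum_(n < N) of_real k ((-1) ^+ e ord0 n * w ord0 n `^ (1 - s^-1)) * A x n.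
  rewrite big_fcons; apply: eq_bigr => n _; rewrite -[in RHS]xT.
  rewrite (lin_coord_expand x N (lin_coord_multilinear n Al)) mulr_sumr.
  apply: eq_bigr => g _; rewrite big_ord_recl fcons0 /U ucons0 of_realM mulrA of_real_prod.
  congr (_ * _ * _).
    by apply: eq_bigr => j _; rewrite fconsS uconsS xE.
  congr (A _ _); apply/funext => j; by rewrite fconsS.
apply: le_trans (le_modulus_sum _ _ _) _.
have h : \sum_(n < N) w ord0 n `^ (1 - s^-1) * (modulus (A x n) `^ s) `^ s^-1 <= B.
  under eq_bigr do rewrite mulrC.
  apply: le_trans (hoelder_sum _ _ _ _ _) _ => //.
  - by rewrite invr_ge0 ltW.
  - by rewrite invf_le1.
  - by move=> n; exact: powR_ge0.
  have := lp_norm_psum_le N s0 B0 Ax => hB.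
  rewrite -[leRHS]mulr1; apply: ler_pM; rewrite ?powR_ge0 //.
    rewrite -[leRHS](powRr1 B0) -(divff (lt0r_neq0 s0)) powRrM.
    apply: ge0_ler_powR; rewrite ?nnegrE ?powR_ge0 ?invr_ge0 ?(ltW s0) //.
    by apply: sumr_ge0 => n _; exact: powR_ge0.
  have E1 : 1 = 1 `^ (1 - s^-1) :> R by rewrite powR1.
  rewrite [leRHS]E1; apply: ge0_ler_powR; rewrite ?nnegrE //.
    by rewrite subr_ge0 invf_le1.
  by apply: sumr_ge0.
apply: le_trans h; apply: ler_sum => n _; rewrite modulusM modulus_of_real.
rewrite normrM normrX normrN1 expr1n mul1r ger0_norm ?powR_ge0 //.
by rewrite -powRrM divff ?gt_eqF // powRr1 ?modulus_ge0.
Qed.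

(** The sign argument is real, so it is applied to the real and imaginary parts separately. The m +
    1 coordinates give 2^(m + 1) and adding the two parts doubles it. *)
Lemma mixed_norm_le s B N (w : 'I_m.+1 -> 'I_N -> R) l :
  1 <= s -> 0 <= B -> multilinear_on p A -> (op_norm p s A <= B%:E)%E ->
  (forall l i, 0 <= w l i) -> (forall l, \sum_i w l i <= 1) ->
  \sum_i Num.sqrt (\sum_(f : {ffun 'I_m.+1 -> 'I_N} | f l == i)
    (modulus (A (fun j => unit_seq R k (f (lift ord0 j))) (f ord0)) *
     \prod_l w l (f l) `^ ucons (1 - s^-1) (fun j => fine (p j)^-1) l) ^+ 2)
  <= 2 ^+ m.+2 * B.
Proof.
move=> s1 B0 Al AB w0 w1.
set U := ucons _ _.
pose a (f : {ffun 'I_m.+1 -> 'I_N}) := A (fun j => unit_seq R k (f (lift ord0 j))) (f ord0).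
pose W (f : {ffun 'I_m.+1 -> 'I_N}) := \prod_l w l (f l) `^ U l.
have H (part : K -> R) :
    (forall z, `|part z| <= modulus z) ->
    (forall (c : {ffun 'I_m.+1 -> 'I_N} -> R) z, part (\sum_f of_real k (c f) * z f) = \sum_f c f * part (z f)) ->
    \sum_i Num.sqrt (\sum_(f : {ffun 'I_m.+1 -> 'I_N} | f l == i) (part (a f) * W f) ^+ 2)
      <= 2 ^+ m.+1 * B.
  move=> part_le part_sum; apply: mixed_of_signs => e.
  have := sgn_form_le e s1 B0 Al AB w0 w1; apply: le_trans.
  apply: le_trans (part_le _); rewrite part_sum; apply: le_trans (ler_norm _).
  rewrite le_eqVlt; apply/orP; left; apply/eqP; apply: eq_bigr => f _.
  by rewrite big_split /= -/(a f) -/(W f) -mulrA [W f * _]mulrC.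
have hr := H _ (@re_part_le _ _) (@re_part_sum _ _ _).
have hi := H _ (@im_part_le _ _) (@im_part_sum _ _ _).
have -> : 2 ^+ m.+2 * B = 2 ^+ m.+1 * B + 2 ^+ m.+1 * B by rewrite exprS; ring.
apply: le_trans (lerD hr hi); rewrite -big_split /=; apply: ler_sum => i _.
apply: le_trans (sqrtrD_le _ _); try by apply: sumr_ge0 => f _; exact: sqr_ge0.
rewrite -big_split /= le_eqVlt; apply/orP; left; apply/eqP; congr Num.sqrt.
apply: eq_bigr => f _.
by rewrite -/(a f) -/(W f) !exprMn modulus_sqr mulrDl.
Qed.

Lemma sum_l2_le s r B N :
  1 <= s -> s < 2 -> 0 <= B -> multilinear_on p A -> (op_norm p s A <= B%:E)%E ->
  0 < inv_sum p -> 2 <= r -> r^-1 = s^-1 - inv_sum p ->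
  \sum_(g : {ffun 'I_m -> 'I_N})
    (\sum_(n < N) modulus (A (fun j => unit_seq R k (g j)) n) ^+ 2) `^ (r / 2)
  <= (2 ^+ m.+2 * B) `^ r.
Proof.
move=> s1 s2 B0 Al AB x0 r2 rE.
have s0 : 0 < s by lra.
have := @mixed_to_lp R m N
  (fun f => modulus (A (fun j => unit_seq R k (f (lift ord0 j))) (f ord0)))
  (fun j => fine (p j)^-1) s^-1 r (2 ^+ m.+2 * B).
have -> : \sum_(g : {ffun 'I_m -> 'I_N}) (\sum_(a < N) modulus (A (fun j => unit_seq R k (fcons a g (lift ord0 j)))
      (fcons a g ord0)) ^+ 2) `^ (r / 2) =
  \sum_(g : {ffun 'I_m -> 'I_N})
    (\sum_(n < N) modulus (A (fun j => unit_seq R k (g j)) n) ^+ 2) `^ (r / 2).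
  apply: eq_bigr => g _; congr powR; apply: eq_bigr => n _; rewrite fcons0.
  by congr (modulus (A _ _) ^+ 2); apply/funext => j; rewrite fconsS.
apply => //.
- by move=> f; exact: modulus_ge0.
- move=> j; have [[t -> t1]|->] := one_le_cases (p1 j) => //.
  by rewrite fine_invr invr_ge0; lra.
- by rewrite div1r lef_pV2 ?posrE // ltW.
- by rewrite invf_le1.
- by rewrite mulr_ge0 // exprn_ge0.
- by move=> w w0 w1 l; apply: mixed_norm_le.
Qed.
End SignForms.

(** * From finite boxes to infinite sums *)

Lemma finite_uniform (T : choiceType) (F : set T) (Q : T -> nat -> Prop) :
  finite_set F -> (forall f N M, (N <= M)%N -> Q f N -> Q f M) ->
  (forall f, exists N, Q f N) -> exists N, forall f, F f -> Q f N.
Proof.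
move=> /finite_seqP[s ->] Qmono Qex.
elim: s => [|f s [N IH]]; first by exists 0%N.
have [M QM] := Qex f.
exists (maxn M N) => g /=; rewrite inE => /predU1P[->|gs].
  by apply: Qmono QM; rewrite leq_maxl.
by apply: Qmono (IH g gs); rewrite leq_maxr.
Qed.

Definition ffun_val m N (g : {ffun 'I_m -> 'I_N}) : {ffun 'I_m -> nat} :=
  [ffun j => val (g j)].

Lemma ffun_val_inj m N : injective (@ffun_val m N).
Proof.
move=> g h /ffunP e; apply/ffunP => j; apply: val_inj.
by have := e j; rewrite !ffunE.
Qed.

Lemma fsum_box_le (R : realType) m N (F : set {ffun 'I_m -> nat})
    (b : {ffun 'I_m -> nat} -> \bar R) :
  (forall f, 0 <= b f)%E -> finite_set F -> (forall f, F f -> forall j, (f j < N)%N) ->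
  (\sum_(f \in F) b f <= \sum_(g : {ffun 'I_m -> 'I_N}) b (ffun_val g))%E.
Proof.
move=> b0 finF FN.
set e := index_enum _; rewrite -(big_map (@ffun_val m N) xpredT b).
rewrite [leRHS]fsbig_seq; last by rewrite map_inj_uniq ?index_enum_uniq //; exact: ffun_val_inj.
apply: lee_fsum_nneg_subset => //; last first.
apply/subsetP => f Ff /=; apply/mapP.
have fN := FN f Ff.
exists [ffun j => Ordinal (fN j)]; first by rewrite mem_index_enum.
by apply/ffunP => j; rewrite !ffunE.
Qed.

Lemma esum_le_of_finite (R : realType) (T : choiceType) (b : T -> \bar R) (B : \bar R) :
  (forall F, finite_set F -> \sum_(f \in F) b f <= B)%E ->
  (\esum_(f in [set: T]) b f <= B)%E.
Proof. by move=> h; apply: ge_ereal_sup => /= _ [F [finF _] <-]; exact: h. Qed.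

Section SequenceNorms.
Context (R : realType) (k : scalar_kind).
Local Notation K := (Defs.scalar R k).
Local Notation modulus := (@Defs.modulus R k).

Lemma lp_norm_unit (p : \bar R) i : (1 <= p)%E -> (lp_norm p (unit_seq R k i) <= 1)%E.
Proof.
move=> p1; apply: (@lp_norm_weight_le1 _ _ _ _ (fun n => (n == i)%:R) i.+1) => //.
- rewrite big_ord_recr /= eqxx big1 ?add0r // => n _.
  by rewrite ltn_eqF.
- move=> n; rewrite /unit_seq; case: eqP => _; rewrite ?modulus1 ?powR1 //.
  by rewrite modulus0 powR_ge0.
- by move=> n ni; rewrite /unit_seq gtn_eqF.
Qed.

Lemma sum_powR_le (s t B : R) (y : nat -> K) N : 1 <= s -> s <= t -> 0 < B ->
  (lp_norm s%:E y <= B%:E)%E -> \sum_(n < N) modulus (y n) `^ t <= B `^ t.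
Proof.
move=> s1 st B0 yB; have s0 : 0 < s by lra.
have yn n : modulus (y n) <= B.
  by rewrite -lee_fin; apply: le_trans yB; apply: lp_norm_coord; rewrite lee_fin.
have -> : B `^ t = B `^ s * B `^ (t - s).
  rewrite -powRD; first by congr powR; lra.
  by apply/implyP => _; rewrite gt_eqF.
apply: le_trans (ler_wpM2r (powR_ge0 _ _) (lp_norm_psum_le N s0 (ltW B0) yB)).
rewrite mulr_suml; apply: ler_sum => n _.
have := modulus_ge0 (y n); rewrite le_eqVlt => /predU1P[<-|y0].
  by rewrite powR0 ?mulr_ge0 ?powR_ge0 //; apply/eqP; lra.
have -> : modulus (y n) `^ t = modulus (y n) `^ s * modulus (y n) `^ (t - s).
  rewrite -powRD; first by congr powR; lra.
  by apply/implyP => _; rewrite gt_eqF.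
rewrite ler_wpM2l ?powR_ge0 //; apply: ge0_ler_powR; rewrite ?nnegrE ?modulus_ge0 ?(ltW B0) //.
by rewrite subr_ge0.
Qed.

(** Replaces an infinite norm by a finite partial sum at the price of a constant, so that no limit
    in the entries is needed. If every partial sum failed, the norm would be at most 2^(-1/q) times
    itself while being positive. *)
Lemma lp_norm_half (q B : R) (y : nat -> K) : 1 <= q -> 0 <= B ->
  (lp_norm q%:E y <= B%:E)%E ->
  exists N, (lp_norm q%:E y <= ((2 * \sum_(n < N) modulus (y n) `^ q) `^ q^-1)%:E)%E.
Proof.
move=> q1 B0 yB; have q0 : 0 < q by lra.
apply: contrapT => /forallNP h.
have y0 : (0 <= lp_norm q%:E y)%E by exact: Lnorm_ge0.
have [X XE] : exists X, lp_norm q%:E y = X%:E.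
  by move: yB y0; case: lp_norm => [X _ _|//|//]; exists X.
rewrite XE in h y0; rewrite lee_fin in y0.
have X0 : 0 < X.
  have := h 0%N; rewrite lee_fin => /negP; rewrite -ltNge big_ord0 mulr0 powR0 //.
  by rewrite invr_eq0 gt_eqF.
pose Y := X / 2 `^ q^-1.
have p2 : 0 < 2 `^ q^-1 :> R by rewrite powR_gt0.
have : (lp_norm q%:E y <= Y%:E)%E.
  apply: lp_norm_le; rewrite ?divr_ge0 ?(ltW X0) ?(ltW p2) // => N.
  have := h N; rewrite lee_fin => /negP; rewrite -ltNge => hN.
  set S := \sum_(n < N) _ in hN *.
  have S0 : 0 <= S by apply: sumr_ge0 => n _; exact: powR_ge0.
  rewrite /Y powR_div ?(ltW p2) // -powRrM mulVf ?gt_eqF // powRr1 //.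
  rewrite ler_pdivlMr // mulrC.
  have -> : 2 * S = ((2 * S) `^ q^-1) `^ q.
    by rewrite -powRrM mulVf ?gt_eqF // powRr1 // mulr_ge0.
  by apply: ge0_ler_powR; rewrite ?nnegrE ?powR_ge0 ?(ltW q0) ?(ltW X0) ?(ltW hN).
rewrite XE lee_fin /Y ler_pdivlMr // -[leRHS]mulr1 ler_pM2l // leNgt => /negP; apply.
have E1 : 1 = 1 `^ q^-1 :> R by rewrite powR1.
by rewrite [ltLHS]E1; apply: gt0_ltr_powR; rewrite ?nnegrE ?invr_gt0 //; lra.
Qed.
End SequenceNorms.

Section SummingUpper.
Context (R : realType) (k : scalar_kind) (m : nat) (p : 'I_m -> \bar R).
Local Notation K := (Defs.scalar R k).
Local Notation modulus := (@Defs.modulus R k).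
Hypothesis p1 : forall j, (1 <= p j)%E.

Lemma op_norm_unit_ge (A : ('I_m -> nat -> K) -> nat -> K) s B (f : 'I_m -> nat) :
  (op_norm p s A <= B%:E)%E ->
  (lp_norm s%:E (A (fun j => unit_seq R k (f j))) <= B%:E)%E.
Proof.
move=> AB; apply: (op_norm_ge p1 AB) => j; first exact: finite_supp_unit.
exact: lp_norm_unit.
Qed.

(* Interpolates between [q = s], where every term is at most [B], and [q = 2]. *)
Lemma sum_lq_le (A : ('I_m -> nat -> K) -> nat -> K) s q rho r B N :
  1 <= s -> s < 2 -> s <= q -> q <= 2 -> 0 < B ->
  multilinear_on p A -> (op_norm p s A <= B%:E)%E ->
  0 < inv_sum p -> 2 <= r -> r^-1 = s^-1 - inv_sum p ->
  0 < rho -> r <= 2 * ((q - s) / (2 - s)) / q * rho ->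
  \sum_(g : {ffun 'I_m -> 'I_N})
    (\sum_(n < N) modulus (A (fun j => unit_seq R k (g j)) n) `^ q) `^ (rho / q)
  <= (2 ^+ m.+2) `^ r * B `^ rho.
Proof.
move=> s1 s2 sq q2 B0 Al AB x0 r2 rE rho0 rrho.
have s0 : 0 < s by lra.
have q0 : 0 < q by lra.
set t := (q - s) / (2 - s) in rrho.
have t0 : 0 <= t by rewrite divr_ge0 //; lra.
have t1 : t <= 1 by rewrite ler_pdivrMr; lra.
have qE : q = s * (1 - t) + 2 * t by rewrite /t; field; lra.
have BrE : (2 ^+ m.+2) `^ r * B `^ rho = B `^ (rho - r) * (2 ^+ m.+2 * B) `^ r.
  have -> : B `^ rho = B `^ (rho - r) * B `^ r.
    rewrite -powRD; first by congr powR; lra.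
    by apply/implyP => _; rewrite gt_eqF.
  by rewrite [in RHS]powRM ?exprn_ge0 ?(ltW B0) // mulrCA.
rewrite BrE.
apply: le_trans (ler_wpM2l (powR_ge0 _ _) (sum_l2_le p1 N s1 s2 (ltW B0) Al AB x0 r2 rE)).
rewrite mulr_sumr; apply: ler_sum => g _.
set y := A _; pose a (n : 'I_N) := modulus (y n).
have yB : (lp_norm s%:E y <= B%:E)%E by exact: op_norm_unit_ge.
have a0 n : 0 <= a n by exact: modulus_ge0.
have S20 : 0 <= \sum_n a n ^+ 2 by apply: sumr_ge0 => n _; exact: sqr_ge0.
have Ss0 : 0 <= \sum_n a n `^ s by apply: sumr_ge0 => n _; exact: powR_ge0.
have Ss : \sum_n a n `^ s <= B `^ s by apply: (sum_powR_le N s1 _ B0 yB).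
have S2 : \sum_n a n ^+ 2 <= B `^ 2.
  have := sum_powR_le N s1 (ltW s2) B0 yB; apply: le_trans.
  by apply: ler_sum => n _; rewrite powR_mulrn ?modulus_ge0.
have hq := powR_interp a0 s1 sq q2 s2; rewrite -/t in hq.
have rq0 : 0 <= rho / q by rewrite divr_ge0 // ltW.
apply: (@le_trans _ _ (((\sum_n a n `^ s) `^ (1 - t) * (\sum_n a n ^+ 2) `^ t) `^ (rho / q))).
  apply: ge0_ler_powR hq => //; rewrite ?nnegrE ?mulr_ge0 ?powR_ge0 //.
  by apply: sumr_ge0 => n _; exact: powR_ge0.
rewrite powRM ?powR_ge0 // -!powRrM.
(* Only the exponent r/2 of the l_2 sum is needed for [sum_l2_le]. The surplus is nonnegative by the
   bound on r and is paid with powers of B, which dominates the l_2 norm. *)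
have e1 : t * (rho / q) = r / 2 + (t * (rho / q) - r / 2) by lra.
have e2 : 0 <= t * (rho / q) - r / 2.
  have : r <= 2 * (t * (rho / q)) by apply: le_trans rrho _; rewrite le_eqVlt; apply/orP; left; apply/eqP; field; lra.
  lra.
have h1 : (\sum_n a n ^+ 2) `^ (t * (rho / q)) <=
    (\sum_n a n ^+ 2) `^ (r / 2) * B `^ (2 * (t * (rho / q) - r / 2)).
  move: S20; rewrite le_eqVlt => /predU1P[<-|S20].
    rewrite powR0 ?mulr_ge0 ?powR_ge0 //; apply/eqP; lra.
  rewrite {1}e1 powRD; last by apply/implyP => _; rewrite gt_eqF.
  rewrite ler_wpM2l ?powR_ge0 // powRrM.
  by apply: ge0_ler_powR; rewrite ?nnegrE ?powR_ge0 ?(ltW S20).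
have h2 : (\sum_n a n `^ s) `^ ((1 - t) * (rho / q)) <= B `^ (s * ((1 - t) * (rho / q))).
  rewrite [leRHS]powRrM; apply: ge0_ler_powR; rewrite ?nnegrE ?powR_ge0 //.
  by rewrite mulr_ge0 // subr_ge0.
apply: le_trans (ler_pM (powR_ge0 _ _) (powR_ge0 _ _) h2 h1) _.
rewrite mulrCA mulrC le_eqVlt; apply/orP; left; apply/eqP; congr (_ * _).
  rewrite -powRD; last by apply/implyP => _; rewrite gt_eqF.
  have -> // : s * ((1 - t) * (rho / q)) + 2 * (t * (rho / q) - r / 2) = rho - r.
  have -> : s * ((1 - t) * (rho / q)) + 2 * (t * (rho / q) - r / 2) =
    (s * (1 - t) + 2 * t) * (rho / q) - r by lra.
  by rewrite -qE mulrCA divff ?gt_eqF // mulr1.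
Qed.

Lemma esum_lq_le (A : ('I_m -> nat -> K) -> nat -> K) s q rho r B :
  1 <= s -> s < 2 -> s <= q -> q <= 2 -> 0 < B ->
  multilinear_on p A -> (op_norm p s A <= B%:E)%E ->
  0 < inv_sum p -> 2 <= r -> r^-1 = s^-1 - inv_sum p ->
  0 < rho -> r <= 2 * ((q - s) / (2 - s)) / q * rho ->
  (\esum_(i in [set: {ffun 'I_m -> nat}])
     lp_norm q%:E (A (fun j => unit_seq R k (i j))) `^ rho <=
   (2 `^ (rho / q) * ((2 ^+ m.+2) `^ r * B `^ rho))%:E)%E.
Proof.
move=> s1 s2 sq q2 B0 Al AB x0 r2 rE rho0 rrho.
have q1 : 1 <= q by lra.
have q0 : 0 < q by lra.
pose y (f : {ffun 'I_m -> nat}) := A (fun j => unit_seq R k (f j)).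
apply: esum_le_of_finite => F finF.
(* One box must contain the finitely many indices of [F] and also capture half of each q-norm to the
   power q. Both conditions persist as N grows. *)
have [N hN] : exists N, forall f, F f -> (forall j, (f j < N)%N) /\
    (lp_norm q%:E (y f) <= ((2 * \sum_(n < N) modulus (y f n) `^ q) `^ q^-1)%:E)%E.
  apply: finite_uniform => // [f N M NM [fN yN]|f].
    split=> [j|]; first exact: leq_trans (fN j) NM.
    apply: le_trans yN _; rewrite lee_fin.
    have mono N' : 0 <= 2 * \sum_(n < N') modulus (y f n) `^ q.
      by rewrite mulr_ge0 // sumr_ge0 // => n _; exact: powR_ge0.
    apply: ge0_ler_powR; rewrite ?nnegrE ?invr_ge0 ?(ltW q0) // ler_wpM2l //.
    rewrite -!(big_mkord xpredT (fun n => modulus (y f n) `^ q)).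
    rewrite [leRHS](big_cat_nat (leq0n N) NM) /= lerDl.
    by apply: sumr_ge0 => n _; exact: powR_ge0.
  have yB : (lp_norm q%:E (y f) <= B%:E)%E.
    apply: lp_norm_le => // [|N]; first exact: ltW.
    by apply: (sum_powR_le N s1 sq B0); exact: op_norm_unit_ge.
  have [N hN] := lp_norm_half q1 (ltW B0) yB.
  exists (maxn N (\max_j (f j).+1)%N); split => [j|].
    by rewrite leq_max; apply/orP; right; rewrite (leq_bigmax j).
  apply: le_trans hN _; rewrite lee_fin.
  have mono N' : 0 <= 2 * \sum_(n < N') modulus (y f n) `^ q.
    by rewrite mulr_ge0 // sumr_ge0 // => n _; exact: powR_ge0.
  apply: ge0_ler_powR; rewrite ?nnegrE ?invr_ge0 ?(ltW q0) // ler_wpM2l //.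
  rewrite -!(big_mkord xpredT (fun n => modulus (y f n) `^ q)).
  rewrite [leRHS](big_cat_nat (leq0n N) (leq_maxl _ _)) /= lerDl.
  by apply: sumr_ge0 => n _; exact: powR_ge0.
pose b f : R := 2 `^ (rho / q) * (\sum_(n < N) modulus (y f n) `^ q) `^ (rho / q).
apply: (@le_trans _ _ (\sum_(f \in F) (b f)%:E)%E).
  apply: lee_fsum => // f Ff; have [_ yf] := hN f Ff.
  have S0 : 0 <= \sum_(n < N) modulus (y f n) `^ q.
    by apply: sumr_ge0 => n _; exact: powR_ge0.
  have -> : (b f)%:E = (((2 * \sum_(n < N) modulus (y f n) `^ q) `^ q^-1)%:E `^ rho)%E.
    by rewrite poweR_EFin -powRrM [q^-1 * _]mulrC powRM.
  apply: gt0_ler_poweR yf; rewrite ?in_itv /= ?leey ?andbT ?(ltW rho0) //.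
    exact: Lnorm_ge0.
  by rewrite lee_fin powR_ge0.
have b0 f : (0 <= (b f)%:E)%E by rewrite lee_fin mulr_ge0 ?powR_ge0.
apply: (le_trans (fsum_box_le b0 finF (fun f Ff => (hN f Ff).1))).
rewrite sumEFin lee_fin -mulr_sumr ler_wpM2l ?powR_ge0 //.
apply: le_trans (sum_lq_le N s1 s2 sq q2 B0 Al AB x0 r2 rE rho0 rrho).
rewrite le_eqVlt; apply/orP; left; apply/eqP; apply: eq_bigr => g _.
congr powR; apply: eq_bigr => n _; congr (modulus (A _ _) `^ _).
by apply/funext => j; rewrite ffunE.
Qed.

Lemma summing_upper s q rho : 0 < inv_sum p -> 1 / 2 < inv_sum p ->
  1 <= s -> s < 2 -> s <= q -> q <= 2 -> 0 < rho ->
  1 / rho <= (1 / s - 1 / q) * (1 / s - inv_sum p) / (1 / s - 1 / 2) ->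
  summing_property R k p s q rho.
Proof.
move=> x0 x2 s1 s2 sq q2 rho0 hrho.
have s0 : 0 < s by lra.
have q0 : 0 < q by lra.
set x := inv_sum p in x0 x2 hrho.
(* The interpolation parameter with 1/q = (1 - th)/s + th/2, so that the hypothesis reads 1/rho <=
   th / r. *)
pose th := 2 * ((q - s) / (2 - s)) / q.
have th0 : 0 <= th by rewrite divr_ge0 ?(ltW q0) // mulr_ge0 // divr_ge0; lra.
have thE : (1 / s - 1 / q) * (1 / s - x) / (1 / s - 1 / 2) = th * (s^-1 - x).
  rewrite /th; field; do ?[apply/andP; split]; apply/eqP; lra.
rewrite thE in hrho.
have irho : 0 < 1 / rho by rewrite divr_gt0.
(* Otherwise the right-hand side of the hypothesis would be nonpositive, against 1/rho > 0. *)
have sx : 0 < s^-1 - x.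
  rewrite ltNge; apply/negP => h.
  have : th * (s^-1 - x) <= 0 by rewrite mulr_ge0_le0.
  lra.
pose r := (s^-1 - x)^-1.
have r0 : 0 < r by rewrite invr_gt0.
have is1 : s^-1 <= 1 by rewrite invf_le1.
(* 1/r = 1/s - x <= 1 - x < 1/2. *)
have r2 : 2 <= r.
  rewrite -[leLHS]invrK lef_pV2 ?posrE ?invr_gt0 //; lra.
have rrho : r <= th * rho.
  move: hrho; rewrite ler_pdivrMr // mulrAC => h.
  by rewrite -[leLHS]mul1r ler_pdivrMr.
pose C : R := (2 `^ (rho / q) * (2 ^+ m.+2) `^ r) `^ rho^-1.
have C0 : 0 < C by rewrite powR_gt0 // mulr_gt0 ?powR_gt0 // exprn_gt0.
exists C => // A [_ Al _].
set L := (X in (X <= _)%E).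
(* Stated for all positive upper bounds B because the operator norm may be 0. The norm itself is
   reached at the end by letting B decrease to it. *)
have key B : 0 < B -> (op_norm p s A <= B%:E)%E -> (L <= (C * B)%:E)%E.
  move=> B0 AB.
  have := @esum_lq_le A s q rho r B s1 s2 sq q2 B0 Al AB x0 r2 (invrK _) rho0 rrho.
  rewrite /L => h.
  have -> : (C * B)%:E = ((2 `^ (rho / q) * ((2 ^+ m.+2) `^ r * B `^ rho))%:E `^ rho^-1)%E.
    rewrite poweR_EFin mulrA [in RHS]powRM ?mulr_ge0 ?powR_ge0 // -/C -powRrM.
    by rewrite divff ?gt_eqF // powRr1 // ltW.
  apply: gt0_ler_poweR h; rewrite ?in_itv /= ?leey ?andbT ?invr_ge0 ?(ltW rho0) //.
    by apply: esum_ge0 => f _; exact: poweR_ge0.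
  by rewrite lee_fin mulr_ge0 ?powR_ge0 // mulr_ge0 ?powR_ge0.
have N0 : (0 <= op_norm p s A)%E.
  apply: (@le_trans _ _ (lp_norm s%:E (A (fun=> unit_seq R k 0)))); first exact: Lnorm_ge0.
  apply: ereal_sup_ubound; exists (fun=> unit_seq R k 0) => //.
  by split => j; [exact/finite_supp_Xspace/finite_supp_unit|exact: lp_norm_unit].
case NE : (op_norm p s A) N0 => [B| |] // B0; last first.
  by rewrite gt0_muley ?lte_fin // leey.
apply/lee_addgt0Pr => e e0; rewrite -EFinM -EFinD.
have -> : C * B + e = C * (B + e / C) by field; rewrite gt_eqF.
rewrite lee_fin in B0.
apply: key; first by rewrite ltr_wpDl // divr_gt0.
by rewrite NE lee_fin lerDl divr_ge0 // ltW.
Qed.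
End SummingUpper.

(** * Diagonal operators *)

Section Diagonal.
Context (R : realType) (k : scalar_kind) (m : nat) (p : 'I_m -> \bar R).
Local Notation K := (Defs.scalar R k).
Local Notation modulus := (@Defs.modulus R k).
Hypothesis p1 : forall j, (1 <= p j)%E.

Lemma prod_continuous (J : Type) (r : seq J) (x : J -> K) (eta : R) : 0 < eta ->
  exists2 delta : R, 0 < delta & forall y : J -> K,
    (forall j, modulus (y j - x j) < delta) ->
    modulus (\prod_(j <- r) y j - \prod_(j <- r) x j) < eta.
Proof.
elim: r eta => [|a r IH] eta eta0.
  by exists 1 => // y _; rewrite !big_nil subrr modulus0.
set P := \prod_(j <- r) x j.
have xa0 : 0 < modulus (x a) + 1 by rewrite ltr_wpDl ?modulus_ge0.
have P0 : 0 < modulus P + 1 by rewrite ltr_wpDl ?modulus_ge0.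
have e10 : 0 < eta / 2 / (modulus (x a) + 1) by rewrite !divr_gt0.
have [d d0 hd] := IH _ e10.
exists (Num.min d (Num.min 1 (eta / 2 / (modulus P + 1)))).
  by rewrite !lt_min d0 ltr01 !divr_gt0.
move=> y hy; rewrite !big_cons -/P.
have ya : modulus (y a) <= modulus (x a) + 1.
  have := hy a; rewrite !lt_min => /andP[_ /andP[h1 _]].
  have := le_modulusD (y a - x a) (x a); rewrite subrK; lra.
have yP : modulus (\prod_(j <- r) y j - P) < eta / 2 / (modulus (x a) + 1).
  by apply: hd => j; have := hy j; rewrite lt_min => /andP[].
have yx : modulus (y a - x a) <= eta / 2 / (modulus P + 1).
  by have := hy a; rewrite !lt_min => /andP[_ /andP[_ /ltW]].
have -> : y a * \prod_(j <- r) y j - x a * P =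
  y a * (\prod_(j <- r) y j - P) + (y a - x a) * P by ring.
apply: le_lt_trans (le_modulusD _ _) _; rewrite !modulusM.
have h1 : modulus (y a) * modulus (\prod_(j <- r) y j - P) < eta / 2.
  apply: (@le_lt_trans _ _ ((modulus (x a) + 1) * modulus (\prod_(j <- r) y j - P))).
    by rewrite ler_wpM2r ?modulus_ge0.
  by rewrite mulrC -ltr_pdivlMr.
have h2 : modulus (y a - x a) * modulus P <= eta / 2.
  apply: (@le_trans _ _ (modulus (y a - x a) * (modulus P + 1))).
    by rewrite ler_wpM2l ?modulus_ge0 // lerDl.
  by rewrite -ler_pdivlMr.
lra.
Qed.

Definition diag_op n N (v : nat -> nat -> K) (x : 'I_m -> nat -> K) : nat -> K :=
  fun c => if (c < N)%N then \sum_(i < n) (\prod_j x j i) * v i c else 0.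

Lemma diag_op_supp n N v x : finite_supp (diag_op n N v x).
Proof. by exists N => c Nc; rewrite /diag_op ltnNge Nc. Qed.

Lemma multilinear_diag_op n N v : multilinear_on p (diag_op n N v).
Proof.
move=> x j a u w _ _ _; apply/funext => c; rewrite /diag_op.
case: ifP => _; last by rewrite mulr0 addr0.
rewrite mulr_sumr -big_split /=; apply: eq_bigr => i _.
have E (z : nat -> K) : \prod_l (@dfwith _ (fun=> nat -> K) x j z) l i =
    z i * \prod_(l | l != j) x l i.
  rewrite (bigD1 j) //= dfwithin; congr (_ * _); apply: eq_bigr => l lj.
  by rewrite dfwithout // eq_sym.
by rewrite !E; ring.
Qed.

Lemma prod_continuous_ord n (x : 'I_m -> nat -> K) (eta : R) : 0 < eta ->
  exists2 delta : R, 0 < delta & forall y : 'I_m -> nat -> K,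
    (forall j i, modulus (y j i - x j i) < delta) ->
    forall i, (i < n)%N -> modulus (\prod_j y j i - \prod_j x j i) < eta.
Proof.
move=> eta0; elim: n => [|n [d d0 hd]]; first by exists 1.
have [d' d'0 hd'] := prod_continuous (index_enum 'I_m) (fun j => x j n) eta0.
exists (Num.min d d'); first by rewrite lt_min d0.
move=> y hy i; rewrite ltnS leq_eqVlt => /predU1P[->|].
  by apply: hd' => j; have := hy j n; rewrite lt_min => /andP[].
by apply: hd => j i'; have := hy j i'; rewrite lt_min => /andP[].
Qed.

Lemma continuous_diag_op n N v s : 1 <= s -> continuous_on p s (diag_op n N v).
Proof.
move=> s1 x _ eps eps0; have s0 : 0 < s by lra.
pose V := 1 + \sum_(i < n) \sum_(c < N) modulus (v i c).
have V0 : 0 < V.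
  by rewrite ltr_pwDl //; do 2![apply: sumr_ge0 => ? _]; exact: modulus_ge0.
pose B := eps / 2; have B0 : 0 < B by rewrite divr_gt0.
(* This makes each of the N entries differ by at most B / (N + 1); as s >= 1, the s-th powers then
   sum to at most B^s. *)
have eta0 : 0 < B / N.+1%:R / V by rewrite !divr_gt0.
have [d d0 hd] := prod_continuous_ord n x eta0.
exists d => // y _ hy.
have hyx j i : modulus (y j i - x j i) < d.
  rewrite -lte_fin; apply: le_lt_trans (hy j).
  exact: (@lp_norm_coord _ _ _ (fun i => y j i - x j i)).
have {}hd := hd y hyx.
have cN c : (c < N)%N -> modulus (diag_op n N v y c - diag_op n N v x c) <= B / N.+1%:R.
  move=> cN; rewrite /diag_op cN -sumrB.
  apply: le_trans (le_modulus_sum _ _ _) _.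
  apply: (@le_trans _ _ (\sum_(i < n) B / N.+1%:R / V * modulus (v i c))).
    apply: ler_sum => i _; rewrite -mulrBl modulusM ler_wpM2r ?modulus_ge0 //.
    exact/ltW/hd.
  rewrite -mulr_sumr mulrAC ler_pdivrMr // ler_wpM2l ?divr_ge0 ?(ltW eps0) ?(ltW B0) //.
  rewrite /V ler_wpDl //; apply: ler_sum => i _.
  rewrite (bigD1 (Ordinal cN)) //= lerDl; apply: sumr_ge0 => ? _; exact: modulus_ge0.
apply: (@le_lt_trans _ _ B%:E); last by rewrite lte_fin /B ltr_pdivrMr //; lra.
apply: lp_norm_le => //; first exact: ltW.
move=> M; pose e c := modulus (diag_op n N v y c - diag_op n N v x c) `^ s.
apply: (le_trans (@sum_trunc_le _ e N M _ _)) => [c|c Nc|]; first exact: powR_ge0.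
  by rewrite /e /diag_op ltnNge Nc /= subrr modulus0 powR0 // gt_eqF.
apply: (@le_trans _ _ (\sum_(c < N) B `^ s / N.+1%:R)); last first.
  rewrite sumr_const card_ord -[_ *+ N]mulr_natr mulrAC ler_pdivrMr //.
  by rewrite ler_wpM2l ?powR_ge0 // ler_nat.
apply: ler_sum => c _; apply: (@le_trans _ _ ((B / N.+1%:R) `^ s)).
  by apply: ge0_ler_powR; rewrite ?nnegrE ?modulus_ge0 ?divr_ge0 ?(ltW eps0) ?(ltW B0) ?(ltW s0) // cN.
rewrite powRM ?invr_ge0 ?(ltW B0) // ler_wpM2l ?powR_ge0 //.
by apply: ge1r_powR => //; rewrite invr_gt0 ltr0Sn /= invf_le1 ?ler1n.
Qed.

Lemma continuous_multilinear_diag_op n N v s : 1 <= s ->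
  continuous_multilinear p s (diag_op n N v).
Proof.
move=> s1; split; [|exact: multilinear_diag_op|exact: continuous_diag_op].
by move=> x _; apply: finite_supp_Xspace; [rewrite lee_fin|exact: diag_op_supp].
Qed.

(** Generalised Hölder, in the language of weights: the product to the power 1/x is at most a
    geometric mean of the weights w_j with exponents u_j / x, and the corresponding arithmetic mean
    has mass at most 1. *)
Lemma prod_ball_sum n (x : 'I_m -> nat -> K) : 0 < inv_sum p ->
  (forall j, (lp_norm (p j) (x j) <= 1)%E) ->
  \sum_(i < n) modulus (\prod_j x j i) `^ (inv_sum p)^-1 <= 1.
Proof.
set X := inv_sum p => X0 x1.
have /choice[w hw] : forall j, exists w : nat -> R, [/\ forall n, 0 <= w n,
    forall N, \sum_(n < N) w n <= 1 & forall n, modulus (x j n) <= w n `^ fine (p j)^-1].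
  by move=> j; exact: lp_norm_le1_weight.
have u0 j : 0 <= fine (p j)^-1.
  have [[t -> t1]|->] := one_le_cases (p1 j) => //.
  by rewrite fine_invr invr_ge0; lra.
apply: (@le_trans _ _ (\sum_(i < n) \sum_j fine (p j)^-1 / X * w j i)).
  apply: ler_sum => i _; rewrite modulus_prod.
  apply: (@le_trans _ _ (\prod_j w j i `^ (fine (p j)^-1 / X))).
    rewrite -prod_powRl => [|j]; last exact: modulus_ge0.
    apply: ler_prod => j _; rewrite powR_ge0 powRrM /=; have [w0 _ h] := hw j.
    by apply: ge0_ler_powR; rewrite ?nnegrE ?modulus_ge0 ?powR_ge0 ?invr_ge0 ?(ltW X0).
  apply: weighted_AMGM => [j||j].
  - by rewrite divr_ge0 // ltW.
  - by rewrite -mulr_suml divff // gt_eqF.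
  - by have [w0 _ _] := hw j.
rewrite exchange_big /=.
apply: (@le_trans _ _ (\sum_j fine (p j)^-1 / X)).
  apply: ler_sum => j _; rewrite -mulr_sumr ler_piMr ?divr_ge0 ?(ltW X0) //.
  by have [_ + _] := hw j; exact.
by rewrite -mulr_suml divff // gt_eqF.
Qed.

Lemma op_norm_diag_op_le n N (v : nat -> nat -> K) s M : 0 < inv_sum p -> 0 < s -> 0 <= M ->
  (forall z : 'I_n -> K, \sum_i modulus (z i) `^ (inv_sum p)^-1 <= 1 ->
    \sum_(c < N) modulus (\sum_i z i * v i c) `^ s <= M `^ s) ->
  (op_norm p s (diag_op n N v) <= M%:E)%E.
Proof.
move=> X0 s0 M0 h; apply: ge_ereal_sup => /= _ [x [_ x1] <-].
apply: lp_norm_le => // L.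
have := h (fun i => \prod_j x j i) (prod_ball_sum n X0 x1); apply: le_trans.
pose e c := modulus (diag_op n N v x c) `^ s.
apply: (le_trans (@sum_trunc_le _ e N L _ _)) => [c|c Nc|]; first exact: powR_ge0.
  by rewrite /e /diag_op ltnNge Nc modulus0 powR0 // gt_eqF.
by apply: ler_sum => c _; rewrite /e /diag_op ltn_ord.
Qed.

Lemma diag_op_unit n N v i : (0 < m)%N -> (i < n)%N ->
  diag_op n N v (fun=> unit_seq R k i) = trunc_seq N (v i).
Proof.
move=> m0 iN; apply/funext => c; rewrite /diag_op /trunc_seq; case: ifP => // _.
rewrite (bigD1 (Ordinal iN)) //= [X in _ + X]big1 ?addr0; last first.
  move=> i' ni; rewrite (bigD1 (Ordinal m0)) //= /unit_seq.
  have -> : (i' == i :> nat) = false by exact: (negbTE ni).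
  by rewrite !mul0r.
by rewrite big1 ?mul1r // => j _; rewrite /unit_seq eqxx.
Qed.

(** Only the n constant multi-indices are kept in the sum; there the operator returns the truncated
    v_i. *)
Lemma summing_diag_op s q rho C n N v M b :
  (0 < m)%N -> 1 <= s -> 0 < rho -> 0 <= b -> 0 < C ->
  (forall A, continuous_multilinear p s A ->
    ((\esum_(i in [set: {ffun 'I_m -> nat}])
        lp_norm q%:E (A (fun j => unit_seq R k (i j))) `^ rho) `^ rho^-1
     <= C%:E * op_norm p s A)%E) ->
  (op_norm p s (diag_op n N v) <= M%:E)%E ->
  (forall i, (i < n)%N -> (b%:E <= lp_norm q%:E (trunc_seq N (v i)))%E) ->
  n%:R `^ rho^-1 * b <= C * M.
Proof.
move=> m0 s1 rho0 b0 C0 hP hM hb.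
rewrite -lee_fin EFinM; apply: (@le_trans _ _ (C%:E * op_norm p s (diag_op n N v))%E); last first.
  by rewrite EFinM lee_pmul2l ?lte_fin.
apply: le_trans (hP _ (continuous_multilinear_diag_op n N v s1)).
have -> : ((n%:R `^ rho^-1)%:E * b%:E)%E = ((n%:R * b `^ rho)%:E `^ rho^-1)%E.
  rewrite poweR_EFin -EFinM powRM ?powR_ge0 // -powRrM.
  by rewrite divff ?gt_eqF // powRr1.
apply: gt0_ler_poweR; rewrite ?in_itv /= ?leey ?andbT ?invr_ge0 ?(ltW rho0) //.
- by rewrite lee_fin mulr_ge0 ?powR_ge0.
- by apply: esum_ge0 => f _; exact: poweR_ge0.
pose cst_ffun (i : nat) : {ffun 'I_m -> nat} := [ffun=> i].
have inj : injective cst_ffun.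
  by move=> i i' /ffunP/(_ (Ordinal m0)); rewrite !ffunE.
apply: esum_ge; exists [set` map cst_ffun (iota 0 n)]%classic; first by split => //; exact: finite_seq.
rewrite -fsbig_seq; last by rewrite map_inj_uniq ?iota_uniq.
rewrite big_map.
apply: (@le_trans _ _ (\sum_(i <- iota 0 n) (b `^ rho)%:E)%E).
  rewrite sumEFin lee_fin big_const_seq count_predT size_iota iter_addr_0.
  by rewrite mulr_natl.
rewrite !big_seq; apply: lee_sum => i; rewrite mem_iota add0n => /andP[_ iN].
have -> : (fun j => unit_seq R k (cst_ffun i j)) = (fun=> unit_seq R k i).
  by apply/funext => j; rewrite ffunE.
rewrite diag_op_unit // -poweR_EFin; apply: gt0_ler_poweR (hb _ iN); rewrite ?in_itv /= ?leey ?andbT ?(ltW rho0) //.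
exact: Lnorm_ge0.
Qed.

(** Since 1/x <= 1 <= s, the unit ball of l_(1/x) lies in that of l_s, so the diagonal operator has
    norm at most 1. The property would give n^(1/rho) <= C for every n. *)
Lemma not_summing_of_ge1 s q rho C : (0 < m)%N -> 1 <= s -> s <= q -> 0 < rho -> 0 < C ->
  1 <= inv_sum p ->
  (forall A, continuous_multilinear p s A ->
    ((\esum_(i in [set: {ffun 'I_m -> nat}])
        lp_norm q%:E (A (fun j => unit_seq R k (i j))) `^ rho) `^ rho^-1
     <= C%:E * op_norm p s A)%E) -> False.
Proof.
move=> m0 s1 sq rho0 C0 X1 hP.
have s0 : 0 < s by lra.
have q1 : (1 <= q%:E)%E by rewrite lee_fin; lra.
have X0 : 0 < inv_sum p by lra.
have H n : n%:R `^ rho^-1 <= C.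
  have := @summing_diag_op s q rho C n n (unit_seq R k) 1 1 m0 s1 rho0 ler01 C0 hP.
  rewrite !mulr1; apply.
    apply: op_norm_diag_op_le => // z hz; rewrite powR1; apply: le_trans (hz).
    have z1 i : modulus (z i) <= 1.
      have : modulus (z i) `^ (inv_sum p)^-1 <= 1.
        apply: le_trans hz; rewrite (bigD1 i) //= lerDl.
        by apply: sumr_ge0 => ? _; exact: powR_ge0.
      apply: contraTT; rewrite -!ltNge => z1.
      have E1 : 1 = 1 `^ (inv_sum p)^-1 :> R by rewrite powR1.
      rewrite [ltLHS]E1; apply: gt0_ltr_powR; rewrite ?nnegrE ?invr_gt0 ?modulus_ge0 //.
    apply: ler_sum => c _.
    rewrite (bigD1 c) //= [X in _ + X]big1 ?addr0; last first.
      by move=> i ic; rewrite /unit_seq eq_sym val_eqE (negbTE ic) mulr0.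
    rewrite /unit_seq eqxx mulr1.
    have := modulus_ge0 (z c); rewrite le_eqVlt => /predU1P[<-|zc].
      by rewrite powR0 ?powR_ge0 // gt_eqF.
    apply: ger_powR; first by rewrite zc z1.
    by apply: le_trans s1; rewrite invf_le1.
  move=> i iN; apply: le_trans (lp_norm_coord _ i q1).
  by rewrite /trunc_seq iN /unit_seq eqxx modulus1.
have [n hn] : exists n : nat, C `^ rho < n%:R.
  by exists (Num.Def.archi_bound (C `^ rho)); apply: archi_boundP; exact: powR_ge0.
have := H n; apply/negP; rewrite -ltNge.
have {1}-> : C = (C `^ rho) `^ rho^-1.
  by rewrite -powRrM divff ?gt_eqF // powRr1 // ltW.
by apply: gt0_ltr_powR; rewrite ?nnegrE ?powR_ge0 ?invr_gt0.
Qed.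
End Diagonal.

(** * Random sign matrices *)

(** The generous constant 2, against the sharp 1/2, lets 1 + x <= exp x suffice: a direct estimate
    for 0 <= x <= 1/2, and x <= 2 x^2 beyond. *)
Lemma cosh_le_expR (R : realType) (x : R) :
  (expR x + expR (- x)) / 2 <= expR (2 * x ^+ 2).
Proof.
wlog x0 : x / 0 <= x => [H|].
  have [x0|/ltW x0] := leP 0 x; first exact: H.
  by have := H (- x); rewrite opprK sqrrN addrC oppr_ge0; apply.
have ex : expR x * expR (- x) = 1 by rewrite -expRD subrr expR0.
have e0 : 0 < expR x by exact: expR_gt0.
have e0' : 0 < expR (- x) by exact: expR_gt0.
have e1 : 1 - x <= expR (- x) by exact: expR_ge1Dx.
have e1' : 1 + x <= expR x by exact: expR_ge1Dx.
have [x2|x2] := leP x (1 / 2).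
  apply: le_trans (expR_ge1Dx _).
  (* [cosh x = 1 + (exp x - 1)^2 / (2 exp x)] and [exp x - 1 <= x exp x] *)
  have h1 : expR x - 1 <= x * expR x by nra.
  have h2 : expR x <= 2 by nra.
  have h3 : (expR x - 1) ^+ 2 <= 2 * (x ^+ 2 * expR x).
    apply: (@le_trans _ _ ((x * expR x) ^+ 2)).
      by rewrite lerXn2r ?nnegrE ?mulr_ge0 ?(ltW e0) //; lra.
    have : 0 <= x ^+ 2 * expR x by rewrite mulr_ge0 ?sqr_ge0 // ltW.
    by nra.
  have h4 : (expR x - 1) ^+ 2 * expR (- x) <= 2 * x ^+ 2.
    have := ler_wpM2r (ltW e0') h3; rewrite -!mulrA ex mulr1; exact.
  have h5 : (expR x - 1) ^+ 2 * expR (- x) = expR x - 2 + expR (- x).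
    transitivity (expR x * (expR x * expR (- x)) - 2 * (expR x * expR (- x)) + expR (- x)).
      by ring.
    by rewrite ex !mulr1.
  lra.
have h : expR x <= expR (2 * x ^+ 2) by rewrite ler_expR; nra.
have h' : expR (- x) <= expR x by rewrite ler_expR; lra.
lra.
Qed.

(** Averaging over one sign produces cosh(2 b z / L), bounded by exp(8 b^2 z^2 / L^2). As 1/L + 8
    b^2 / L^2 <= 1 / (L - 8 b^2), removing a coefficient b lowers L by 8 b^2 and the induction
    continues. *)
Lemma avg_expR_sqr (R : realType) n (a : 'I_n -> R) (L : R) :
  8 * \sum_i a i ^+ 2 < L ->
  avg (fun e => expR ((\sum_i (-1) ^+ e i * a i) ^+ 2 / L)) <=
  expR ((\sum_i a i ^+ 2) / (L - 8 * \sum_i a i ^+ 2)).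
Proof.
elim: n a L => [|n IH] a L.
  rewrite (avg0 _ [ffun => true]) !big_ord0 => _.
  by rewrite expr0n !mul0r.
rewrite big_ord_recl; set b := a ord0; pose a' i := a (lift ord0 i).
set k := \sum_(i < n) _ => Lk.
have k0 : 0 <= k by apply: sumr_ge0 => i _; exact: sqr_ge0.
have b0 := sqr_ge0 b.
have L0 : 0 < L by lra.
have L1 : 0 < L - 8 * b ^+ 2 by lra.
have L2 : 0 < L - 8 * (b ^+ 2 + k) by lra.
have := IH a' (L - 8 * b ^+ 2); rewrite -/k => IH'.
have {}IH' := IH' ltac:(lra).
have -> : (b ^+ 2 + k) / (L - 8 * (b ^+ 2 + k)) =
  b ^+ 2 / (L - 8 * (b ^+ 2 + k)) + k / (L - 8 * b ^+ 2 - 8 * k).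
  by rewrite mulrDl; congr (_ + _ / _); lra.
rewrite expRD; apply: (@le_trans _ _ (expR (b ^+ 2 / L) * avg (fun e : {ffun 'I_n -> bool} =>
    expR ((\sum_i (-1) ^+ e i * a' i) ^+ 2 / (L - 8 * b ^+ 2))))); last first.
  apply: ler_pM IH'; first exact: expR_ge0.
    by rewrite divr_ge0 ?exprn_ge0 // sumr_ge0 // => e _; exact: expR_ge0.
  by rewrite ler_expR ler_wpM2l // lef_pV2 ?posrE //; lra.
rewrite -avgZ avgS; apply: ler_avg => e.
pose z := \sum_i (-1) ^+ e i * a' i.
have E (s : bool) : \sum_i (-1) ^+ fcons s e i * a i = (-1) ^+ s * b + z.
  rewrite big_ord_recl fcons0; congr (_ + _).
  by apply: eq_bigr => i _; rewrite fconsS.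
rewrite !E -/z /= expr1 expr0 mulN1r mul1r.
have -> : (- b + z) ^+ 2 / L = (z ^+ 2 + b ^+ 2) / L + - (2 * b * z / L).
  by field; rewrite gt_eqF.
have -> : (b + z) ^+ 2 / L = (z ^+ 2 + b ^+ 2) / L + 2 * b * z / L.
  by field; rewrite gt_eqF.
rewrite !expRD -mulrDr -mulrA [expR (- _) + _]addrC.
apply: le_trans (ler_wpM2l (expR_ge0 _) (cosh_le_expR _)) _.
rewrite -!expRD ler_expR.
have -> : (z ^+ 2 + b ^+ 2) / L + 2 * (2 * b * z / L) ^+ 2 =
  b ^+ 2 / L + z ^+ 2 * (L^-1 + 8 * b ^+ 2 / L ^+ 2) by field; rewrite gt_eqF.
rewrite lerD2l ler_wpM2l ?sqr_ge0 //.
rewrite -[leRHS]mul1r ler_pdivlMr //.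
have -> : (L^-1 + 8 * b ^+ 2 / L ^+ 2) * (L - 8 * b ^+ 2) = 1 - (8 * b ^+ 2 / L) ^+ 2.
  by field; rewrite gt_eqF.
by rewrite gerBl sqr_ge0.
Qed.

Lemma le_mean_ex (R : realType) (T : finType) (t0 : T) (F : T -> R) (B : R) :
  \sum_t F t <= B * #|T|%:R -> exists t, F t <= B.
Proof.
move=> h; apply/existsP; rewrite -[X in is_true X]negbK negb_exists; apply/negP => /forallP hF.
have : \sum_(t : T) B < \sum_t F t.
  apply: ltr_sum => [|t _]; last by rewrite ltNge hF.
  by apply/hasP; exists t0 => //; rewrite mem_index_enum.
by rewrite sumr_const -[_ *+ _]mulr_natr ltNge h.
Qed.

Definition sgn_val (R : realType) (o : option bool) : R :=
  if o is Some b then (-1) ^+ b else 0.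

Lemma sgn_val_sqr (R : realType) o : sgn_val R o ^+ 2 = (o != None)%:R.
Proof. by case: o => [b|] /=; rewrite ?sqrr_sign // expr0n. Qed.

(* A union bound over the [sigma] in [{-1,0,1}^n], those with [k] nonzero
   entries being charged [(2 n)^(- 2 k)], so that the total charge is at most [e]. *)
Lemma random_sign_matrix (R : realType) n N : (0 < n)%N ->
  exists e : {ffun 'I_N -> {ffun 'I_n -> bool}}, forall sg : 'I_n -> option bool,
  \sum_c (\sum_i (-1) ^+ e c i * sgn_val R (sg i)) ^+ 2 <=
  16 * (\sum_i (sg i != None)%:R) *
   (1 + N%:R / 8 + 2 * ln (2 * n%:R) * \sum_i (sg i != None)%:R).
Proof.
move=> n0.
pose th : R := 2 * ln (2 * n%:R).
have n1 : 1 <= n%:R :> R by rewrite ler1n.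
have eth : expR (- th) = ((2 * n%:R) ^+ 2)^-1.
  by rewrite expRN /th expRM_natl lnK // posrE; lra.
pose k (sg : {ffun 'I_n -> option bool}) : R := \sum_i sgn_val R (sg i) ^+ 2.
have k0 sg : 0 <= k sg by apply: sumr_ge0 => i _; exact: sqr_ge0.
pose Y (e : {ffun 'I_N -> {ffun 'I_n -> bool}}) (sg : {ffun 'I_n -> option bool}) : R :=
  \sum_c (\sum_i (-1) ^+ e c i * sgn_val R (sg i)) ^+ 2.
pose F e := \sum_(sg : {ffun 'I_n -> option bool}) expR (- (th * k sg)) * expR (Y e sg / (16 * k sg)).
have [e he] : exists e, F e <= expR (1 + N%:R / 8).
  apply: (@le_mean_ex _ _ [ffun => [ffun => true]]).
  rewrite /F exchange_big /=.
  have Ecard : #|{ffun 'I_N -> {ffun 'I_n -> bool}}|%:R = (2 ^+ n) ^+ N :> R.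
    by rewrite !card_ffun card_bool !card_ord !natrX.
  (* The N sign vectors [e c] are independent, so the average factors. By [avg_expR_sqr] with L = 16
     k, each factor is at most exp(k / (16 k - 8 k)) = exp(1/8). *)
  have HY (sg : {ffun 'I_n -> option bool}) : \sum_e expR (Y e sg / (16 * k sg)) <= expR (N%:R / 8) * (2 ^+ n) ^+ N.
    have -> : \sum_e expR (Y e sg / (16 * k sg)) =
      \sum_(e : {ffun 'I_N -> {ffun 'I_n -> bool}}) \prod_c
        expR ((\sum_i (-1) ^+ e c i * sgn_val R (sg i)) ^+ 2 / (16 * k sg)).
      by apply: eq_bigr => e _; rewrite /Y mulr_suml expR_sum.
    rewrite -(bigA_distr_bigA (fun _ (d : {ffun 'I_n -> bool}) =>
      expR ((\sum_i (-1) ^+ d i * sgn_val R (sg i)) ^+ 2 / (16 * k sg)))) /=.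
    rewrite expRM_natl -exprMn.
    rewrite prodr_const card_ord lerXn2r ?nnegrE ?mulr_ge0 ?expR_ge0 ?exprn_ge0 //.
      by apply: sumr_ge0 => d _; exact: expR_ge0.
    rewrite -ler_pdivrMr ?exprn_gt0 //.
    (* When k = 0, the inverse of 0 is 0 and every exponential is 1. *)
    have := k0 sg; rewrite le_eqVlt => /predU1P[ks|ks].
      rewrite -ks mulr0 invr0.
      under eq_bigr do rewrite mulr0 expR0.
      rewrite sumr_const card_ffun card_bool card_ord -[_ *+ _]mulr_natr natrX mul1r.
      by rewrite divff ?expf_neq0 // -expR0 ler_expR invr_ge0.
    have := @avg_expR_sqr R n (fun i => sgn_val R (sg i)) (16 * k sg).
    rewrite -/(k sg) => H; apply: le_trans (H _) _; first lra.
    rewrite ler_expR; have -> : 16 * k sg - 8 * k sg = 8 * k sg by lra.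
    by rewrite invfM mulrCA divff ?gt_eqF // mulr1.
  apply: (@le_trans _ _ (\sum_(sg : {ffun 'I_n -> option bool})
      expR (- (th * k sg)) * (expR (N%:R / 8) * (2 ^+ n) ^+ N))).
    by apply: ler_sum => sg _; rewrite -mulr_sumr ler_wpM2l ?expR_ge0.
  rewrite -mulr_suml expRD Ecard -[leRHS]mulrA.
  rewrite ler_wpM2r ?mulr_ge0 ?expR_ge0 ?exprn_ge0 //.
  have -> : \sum_sg expR (- (th * k sg)) =
    \sum_(sg : {ffun 'I_n -> option bool}) \prod_i expR (- th * sgn_val R (sg i) ^+ 2).
    by apply: eq_bigr => sg _; rewrite -expR_sum -mulr_sumr mulNr.
  rewrite -(bigA_distr_bigA (fun _ o => expR (- th * sgn_val R o ^+ 2))) /=.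
  (* The total charge is (1 + 2 exp(- th))^n <= exp(2 n / (2 n)^2) <= e. *)
  have -> : \sum_o expR (- th * sgn_val R o ^+ 2) = 1 + 2 * expR (- th).
    rewrite (bigD1 None) //= expr0n mulr0 expR0; congr (_ + _).
    rewrite (bigD1 (Some true)) //= (bigD1 (Some false)) //= big1 ?addr0.
      by rewrite sqrrN expr1n mulr1; lra.
    by case=> [[]|].
  rewrite prodr_const card_ord.
  apply: (@le_trans _ _ (expR (2 * expR (- th)) ^+ n)).
    by rewrite lerXn2r ?nnegrE ?expR_ge0 ?expR_ge1Dx // addr_ge0 // mulr_ge0 // expR_ge0.
  rewrite -expRM_natl ler_expR eth -ler_pdivlMl; last lra.
  rewrite mulr1 -invf_div lef_pV2 ?posrE ?invr_gt0 ?divr_gt0 //; try lra.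
    by nra.
  by rewrite exprn_gt0 //; lra.
exists e => sg.
have kE : k [ffun i => sg i] = \sum_i (sg i != None)%:R.
  by apply: eq_bigr => i _; rewrite ffunE sgn_val_sqr.
have YE : Y e [ffun i => sg i] = \sum_c (\sum_i (-1) ^+ e c i * sgn_val R (sg i)) ^+ 2.
  by apply: eq_bigr => c _; congr (_ ^+ 2); apply: eq_bigr => i _; rewrite ffunE.
rewrite -kE -YE; set sg' := finfun _.
have := k0 sg'; rewrite le_eqVlt => /predU1P[ks|ks].
  rewrite -ks mulr0 mul0r /Y big1 // => c _; rewrite big1 ?expr0n // => i _.
  have := psumr_eq0P (fun i _ => sqr_ge0 (sgn_val R (sg' i))) (esym ks) => /(_ i isT)/eqP.
  by rewrite sqrf_eq0 => /eqP ->; rewrite mulr0.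
have : expR (- (th * k sg')) * expR (Y e sg' / (16 * k sg')) <= expR (1 + N%:R / 8).
  apply: le_trans he; rewrite /F (bigD1 sg') //= lerDl.
  by apply: sumr_ge0 => ? _; rewrite mulr_ge0 ?expR_ge0.
rewrite -expRD ler_expR addrC -lerBrDr opprK ler_pdivrMr ?mulr_gt0 //.
by rewrite mulrC /th.
Qed.

Section SignMatrix.
Context (R : realType) (n N : nat) (e : {ffun 'I_N -> {ffun 'I_n -> bool}}) (th : R).
Hypothesis th0 : 0 <= th.
Hypothesis he : forall sg : 'I_n -> option bool,
  \sum_c (\sum_i (-1) ^+ e c i * sgn_val R (sg i)) ^+ 2 <=
  16 * (\sum_i (sg i != None)%:R) * (1 + N%:R / 8 + th * \sum_i (sg i != None)%:R).

Definition sq_norm (a : 'I_n -> R) : R := \sum_c (\sum_i (-1) ^+ e c i * a i) ^+ 2.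

(* The convex function [sq_norm] is largest at sign vectors. *)
Lemma sq_norm_box (S : pred 'I_n) (a : 'I_n -> R) :
  (forall i, `|a i| <= (S i)%:R) ->
  sq_norm a <= 16 * (\sum_i (S i)%:R) * (1 + N%:R / 8 + th * \sum_i (S i)%:R).
Proof.
move=> aS; pose y c := \sum_i (-1) ^+ e c i * a i.
pose t i := \sum_c y c * (-1) ^+ e c i.
(* With M the sign matrix and t = M^T M a, these signs maximise the linear form <., t> on the box.
   Hence Q = <a, t> <= <M a, M sg>, and Cauchy-Schwarz gives Q^2 <= Q P. *)
pose sg i := if S i then Some (t i < 0)%R else None.
have hs := he sg.
have sgE i : (sg i != None) = S i by rewrite /sg; case: (S i).
have E : \sum_i (sg i != None)%:R = \sum_i (S i)%:R :> R by apply: eq_bigr => i _; rewrite sgE.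
rewrite E in hs; apply: le_trans hs.
set P := (X in _ <= X); set Q := sq_norm a.
have Q0 : 0 <= Q by apply: sumr_ge0 => c _; exact: sqr_ge0.
have QE : Q = \sum_i a i * t i.
  rewrite /Q /sq_norm; under [RHS]eq_bigr do rewrite mulr_sumr.
  rewrite exchange_big /=; apply: eq_bigr => c _; rewrite -/(y c) expr2 {2}/y mulr_sumr.
  by apply: eq_bigr => i _; ring.
pose ys c := \sum_i (-1) ^+ e c i * sgn_val R (sg i).
have h : Q <= \sum_c y c * ys c.
  have -> : \sum_c y c * ys c = \sum_i sgn_val R (sg i) * t i.
    under [RHS]eq_bigr do rewrite mulr_sumr.
    rewrite exchange_big /=; apply: eq_bigr => c _; rewrite /ys mulr_sumr.
    by apply: eq_bigr => i _; ring.
  rewrite QE; apply: ler_sum => i _; rewrite /sg; have := aS i.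
  case: (S i) => /= ai; last by rewrite normr_le0 in ai; rewrite (eqP ai).
  apply: le_trans (ler_norm _) _; rewrite normrM.
  apply: (@le_trans _ _ `|t i|); first by rewrite ler_piMl.
  by case: ltrP => ti /=; [rewrite expr1 mulN1r ltr0_norm|rewrite expr0 mul1r ger0_norm].
have cs : (\sum_c y c * ys c) ^+ 2 <= Q * P by exact: cauchy_schwarz_sqr.
have : Q ^+ 2 <= Q * P by apply: le_trans cs; rewrite lerXn2r ?nnegrE //; exact: le_trans h.
move: Q0; rewrite le_eqVlt => /predU1P[<- _|Q0]; last by rewrite expr2 ler_pM2l.
by apply: sumr_ge0 => c _; exact: sqr_ge0.
Qed.

Lemma sq_normZ (a : 'I_n -> R) (b : R) : sq_norm (fun i => b * a i) = b ^+ 2 * sq_norm a.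
Proof.
rewrite /sq_norm mulr_sumr; apply: eq_bigr => c _; rewrite -exprMn; congr (_ ^+ 2).
by rewrite mulr_sumr; apply: eq_bigr => i _; ring.
Qed.

Lemma sq_norm_sum (J : finType) (lev : 'I_n -> J) (a : 'I_n -> R) :
  sq_norm a <= #|J|%:R * \sum_j sq_norm (fun i => if lev i == j then a i else 0).
Proof.
rewrite /sq_norm exchange_big mulr_sumr; apply: ler_sum => c _ /=.
have -> : \sum_i (-1) ^+ e c i * a i =
    \sum_j 1 * \sum_i (-1) ^+ e c i * (if lev i == j then a i else 0).
  under [RHS]eq_bigr do rewrite mul1r.
  rewrite exchange_big; apply: eq_bigr => i _ /=.
  rewrite (bigD1 (lev i)) //= eqxx big1 ?addr0 // => j /negbTE ji.
  by rewrite eq_sym ji mulr0.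
apply: le_trans (cauchy_schwarz_sqr _ _) _.
by rewrite [X in X * _](eq_bigr (fun=> 1)) ?sumr_const // => j _; rewrite expr1n.
Qed.

(** Serves the last dyadic level, where no lower bound on the coordinates limits their number. *)
Lemma sq_norm_small (a : 'I_n -> R) : (forall i, `|a i| <= n%:R^-1) -> sq_norm a <= N%:R.
Proof.
move=> ha; rewrite -[X in _ <= X%:R]card_ord -sumr_const; apply: ler_sum => c _.
rewrite -real_normK ?num_real // expr_le1 //; apply: le_trans (ler_norm_sum _ _ _) _.
apply: (@le_trans _ _ (\sum_(i < n) n%:R^-1)).
  by apply: ler_sum => i _; rewrite normrM normrX normrN1 expr1n mul1r.
rewrite sumr_const card_ord -[_ *+ n]mulr_natr; case: (n) => [|n']; first by rewrite mulr0.
by rewrite mulVf.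
Qed.

(** [(trunc_log 2 n).+2] counts the dyadic levels. It is squared because [sq_norm_sum] costs the
    number of levels and the level bounds are then added up. In 64 = 16 * 4, the 16 comes from the
    matrix and the 4 from 4^(l + 1) against 4^l. *)
Definition dyadic_bound : R :=
  64 * (trunc_log 2 n).+2%:R ^+ 2 * (2 + th).

(* Dyadic decomposition: at most [2^((l + 1) / X)] coordinates of [z] exceed [2^(-l - 1)]. *)
Lemma sq_norm_le (X : R) (z : 'I_n -> R) : 1 / 2 < X -> X < 1 -> (0 < n)%N ->
  n%:R `^ (2 - 2 * X) <= N%:R -> \sum_i `|z i| `^ X^-1 <= 1 ->
  sq_norm z <= N%:R * dyadic_bound.
Proof.
move=> X2 X1 n0 nN hz.
have X0 : 0 < X by lra.
have n1 : 1 <= n%:R :> R by rewrite ler1n.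
have N1 : 1 <= N%:R :> R.
  apply: le_trans nN.
  have {1}-> : 1 = 1 `^ (2 - 2 * X) :> R by rewrite powR1.
  by apply: ge0_ler_powR; rewrite ?nnegrE //; lra.
have z1 i : `|z i| <= 1.
  have : `|z i| `^ X^-1 <= 1.
    by apply: le_trans hz; rewrite (bigD1 i) //= lerDl sumr_ge0 // => ? _; exact: powR_ge0.
  apply: contraTT; rewrite -!ltNge => zi.
  have E1 : 1 = 1 `^ X^-1 :> R by rewrite powR1.
  by rewrite [ltLHS]E1; apply: gt0_ltr_powR; rewrite ?nnegrE ?invr_gt0.
pose L := (trunc_log 2 n).+1.
have nL : n%:R <= 2 ^+ L :> R.
  by rewrite -natrX ler_nat ltnW // trunc_log_ltn.
(* [find] returns [L] when no threshold is exceeded, so level L collects the coordinates that are at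
   most 2^(-L) <= 1/n. *)
pose lev0 i := find (fun l : nat => 2 ^- l.+1 < `|z i|) (iota 0 L).
have lev0L i : (lev0 i < L.+1)%N.
  by rewrite ltnS -[leqRHS](size_iota 0 L) find_size.
pose lev i : 'I_L.+1 := Ordinal (lev0L i).
have lev_up i : `|z i| <= 2 ^- lev i.
  rewrite /lev /=; case E : (lev0 i) => [|l]; first by rewrite expr0 invr1.
  have := @before_find _ 0%N (fun l : nat => 2 ^- l.+1 < `|z i|) (iota 0 L) l.
  rewrite -/(lev0 i) E ltnSn => /(_ isT) /negbT.
  rewrite nth_iota ?add0n -?leNgt //.
  by have := lev0L i; rewrite E ltnS.
have lev_lo i : (lev i < L)%N -> 2 ^- (lev i).+1 < `|z i|.
  move=> iL; have := @nth_find _ 0%N (fun l : nat => 2 ^- l.+1 < `|z i|) (iota 0 L).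
  rewrite has_find size_iota -/(lev0 i) => /(_ iL).
  by rewrite nth_iota.
apply: le_trans (sq_norm_sum lev z) _.
rewrite card_ord.
have levB (l : 'I_L.+1) : sq_norm (fun i => if lev i == l then z i else 0) <=
    N%:R * (64 * (2 + th)).
  have p2 : 0 < 2 ^- l :> R by rewrite invr_gt0 exprn_gt0.
  have [lL|Ll] := ltnP l L; last first.
    apply: (@le_trans _ _ N%:R).
      apply: sq_norm_small => i; case: eqP => [il|_]; last by rewrite normr0 invr_ge0.
      apply: le_trans (lev_up i) _; rewrite il lef_pV2 ?posrE ?exprn_gt0 ?ltr0n //.
      have -> // : (l : nat) = L.
      by apply/eqP; rewrite eqn_leq Ll -ltnS ltn_ord.
    by rewrite ler_peMr //; move: (th) th0 => t t0; lra.
  have -> : (fun i => if lev i == l then z i else 0) =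
      (fun i => 2 ^- l * (if lev i == l then 2 ^+ l * z i else 0)).
    apply/funext => i; case: ifP => _; last by rewrite mulr0.
    by rewrite mulrA mulVf ?mul1r // expf_neq0.
  rewrite sq_normZ.
  pose S i := lev i == l; pose k : R := \sum_i (S i)%:R.
  have hb : sq_norm (fun i => if lev i == l then 2 ^+ l * z i else 0) <=
      16 * k * (1 + N%:R / 8 + th * k).
    apply: sq_norm_box => i; rewrite /S; case: eqP => [il|_] /=; last by rewrite normr0.
    rewrite normrM normrX normr_nat mulrC -ler_pdivlMr ?exprn_gt0 // mul1r -il.
    exact: lev_up.
  apply: le_trans (ler_wpM2l (sqr_ge0 _) hb) _.
  have k0 : 0 <= k by apply: sumr_ge0 => i _; exact: ler0n.
  have kn : k <= n%:R.
    rewrite -[X in _ <= X%:R]card_ord -sumr_const; apply: ler_sum => i _.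
    by case: (S i).
  have h4 : (2 ^- l) ^+ 2 * 4 ^+ l = 1 :> R.
    rewrite -exprVn -exprM mulnC exprM -exprMn.
    have -> : 2^-1 ^+ 2 * 4 = 1 :> R by field.
    by rewrite expr1n.
  (* The first bound handles the part linear in k, the second the part th k^2. Both follow from k^X
     <= 2^(l + 1), the second also from k <= n and n^(2 - 2X) <= N. *)
  suff [kl k2l] : k <= 4 ^+ l.+1 /\ k ^+ 2 <= 4 ^+ l.+1 * N%:R.
    apply: (@le_trans _ _ ((2 ^- l) ^+ 2 * (16 * (4 ^+ l.+1 * (1 + N%:R / 8) + th * (4 ^+ l.+1 * N%:R))))).
      rewrite ler_wpM2l ?sqr_ge0 // -mulrA ler_wpM2l // mulrDr lerD //.
        by rewrite ler_wpM2r // addr_ge0 // divr_ge0.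
      by rewrite mulrCA -expr2 ler_wpM2l.
    have -> : (2 ^- l) ^+ 2 * (16 * (4 ^+ l.+1 * (1 + N%:R / 8) + th * (4 ^+ l.+1 * N%:R))) =
      ((2 ^- l) ^+ 2 * 4 ^+ l) * (64 * ((1 + N%:R / 8) + th * N%:R)).
      rewrite (exprS 4 l); move: ((2 ^- l) ^+ 2) (4 ^+ l) (1 + N%:R / 8) => a b c; ring.
    by rewrite h4 mul1r; nra.
  have [k00|kp] := eqVneq k 0.
    by rewrite k00 expr0n; split; rewrite ?mulr_ge0 ?exprn_ge0.
  have k1 : 1 <= k.
    rewrite /k -natr_sum ler1n lt0n; apply: contra_neq kp => kk.
    by rewrite /k -natr_sum kk.
  have kX : k `^ X <= 2 ^+ l.+1.
    have : k * (2 ^- l.+1) `^ X^-1 <= 1.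
      apply: le_trans hz; rewrite /k mulr_suml; apply: ler_sum => i _.
      rewrite /S; case: eqP => [il|_]; rewrite ?mul1r ?mul0r ?powR_ge0 //.
      apply: ge0_ler_powR; rewrite ?nnegrE ?invr_ge0 ?exprn_ge0 ?(ltW X0) // ltW //.
      by rewrite -il lev_lo // il.
    have p : 0 < (2 ^- l.+1) `^ X^-1 :> R by rewrite powR_gt0 // invr_gt0 exprn_gt0.
    rewrite -ler_pdivlMr // mul1r => h.
    have -> : 2 ^+ l.+1 = (((2 ^- l.+1) `^ X^-1)^-1) `^ X :> R.
      rewrite -powRN -powRrM mulNr mulVf ?gt_eqF // powR_inv1 ?invrK //.
    by apply: ge0_ler_powR; rewrite ?nnegrE ?(ltW X0) ?invr_ge0 ?(ltW p).
  have kXX : k `^ (2 * X) <= 4 ^+ l.+1.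
    rewrite mulrC powRrM powR_mulrn ?powR_ge0 //.
    have -> : 4 = 2 ^+ 2 :> R by ring.
    by rewrite -exprM mulnC exprM lerXn2r ?nnegrE ?powR_ge0 ?exprn_ge0.
  split.
    apply: le_trans kXX; rewrite -[leLHS]powRr1 //; apply: ler_powR => //; lra.
  have -> : k ^+ 2 = k `^ (2 * X) * k `^ (2 - 2 * X).
    rewrite -powRD; last by apply/implyP => _.
    by rewrite -powR_mulrn //; congr powR; lra.
  apply: ler_pM; rewrite ?powR_ge0 //; apply: le_trans nN.
  by apply: ge0_ler_powR; rewrite ?nnegrE //; lra.
apply: (@le_trans _ _ (L.+1%:R * \sum_(l < L.+1) N%:R * (64 * (2 + th)))).
  by rewrite ler_wpM2l //; apply: ler_sum => l _; exact: levB.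
rewrite sumr_const card_ord -[_ *+ L.+1]mulr_natr /dyadic_bound -/L.
by rewrite le_eqVlt; apply/orP; left; apply/eqP; ring.
Qed.
End SignMatrix.

(** * The necessary condition *)

Lemma dyadic_bound_le (R : realType) n : (0 < n)%N ->
  0 <= dyadic_bound n (2 * ln (2 * n%:R : R)) <= 512 * (1 + ln (2 * n%:R)) ^+ 3.
Proof.
move=> n0; have n1 : 1 <= n%:R :> R by rewrite ler1n.
set t : R := ln (2 * n%:R).
have t0 : 0 <= t by rewrite ln_ge0 //; lra.
have lt : (trunc_log 2 n).+2%:R <= 2 * (1 + t) :> R.
  rewrite -natr1 -natr1.
  have : (trunc_log 2 n)%:R <= 2 * t :> R; last lra.
  (* This bounds a logarithm in base 2 by twice the natural one. *)
  have h2 : expR (1 / 2) <= 2 :> R.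
    have ex : expR (1 / 2) * expR (- (1 / 2)) = 1 :> R by rewrite -expRD subrr expR0.
    have e1 : 1 - 1 / 2 <= expR (- (1 / 2)) :> R by exact: expR_ge1Dx.
    have e0 := expR_gt0 (1 / 2 : R); nra.
  have : expR ((trunc_log 2 n)%:R * (1 / 2)) <= expR t :> R.
    rewrite expRM_natl /t lnK ?posrE; last lra.
    apply: (@le_trans _ _ (2 ^+ trunc_log 2 n)).
      by rewrite lerXn2r ?nnegrE ?expR_ge0.
    apply: (@le_trans _ _ n%:R); last lra.
    by rewrite -natrX ler_nat trunc_logP.
  rewrite ler_expR; lra.
rewrite /dyadic_bound; set l := _.+2%:R in lt *.
have l0 : 0 <= l by exact: ler0n.
have l2 : l ^+ 2 <= (2 * (1 + t)) ^+ 2 by rewrite lerXn2r ?nnegrE //; lra.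
apply/andP; split; first by rewrite mulr_ge0 // ?mulr_ge0 ?sqr_ge0 //; lra.
have -> : 512 * (1 + t) ^+ 3 = 64 * (2 * (1 + t)) ^+ 2 * (2 + 2 * t) by ring.
by rewrite ler_wpM2r ?ler_wpM2l //; lra.
Qed.

Lemma powR_not_polylog (R : realType) (d K : R) : 0 < d ->
  ~ (forall n : nat, (0 < n)%N -> n%:R `^ d <= K * (1 + ln (2 * n%:R)) ^+ 2).
Proof.
move=> d0 H.
have K0 : 0 <= K.
  have := H 1%N isT; rewrite powR1 mulr1 => h.
  rewrite leNgt; apply/negP => K0.
  have : K * (1 + ln 2) ^+ 2 <= 0 by rewrite mulr_le0_ge0 ?sqr_ge0 // ltW.
  lra.
(* g <= 1 gives 1 + t <= (1 + g t) / g <= exp(g t) / g, and g <= d/4 keeps the square of this below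
   a multiple of n^(d/2), half of the available power. *)
pose g := Num.min 1 (d / 4).
have g0 : 0 < g by rewrite lt_min ltr01 divr_gt0.
have g1 : g <= 1 by rewrite ge_min lexx.
have gd : g <= d / 4 by rewrite ge_min lexx orbT.
pose K' := K * g ^- 2 * 2 `^ (d / 2).
have K'0 : 0 <= K' by rewrite !mulr_ge0 ?invr_ge0 ?exprn_ge0 ?powR_ge0 // ltW.
have H' (n : nat) : (0 < n)%N -> n%:R `^ (d / 2) <= K'.
  move=> n0; have n1 : 1 <= n%:R :> R by rewrite ler1n.
  set t := ln (2 * n%:R : R).
  have t0 : 0 <= t by rewrite ln_ge0 //; lra.
  have hT : 1 + t <= g^-1 * (2 * n%:R) `^ g.
    rewrite /powR; case: eqVneq => [|_]; first lra.
    rewrite ler_pdivlMl //; apply: le_trans (expR_ge1Dx _); rewrite -/t; nra.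
  have hT2 : (1 + t) ^+ 2 <= g ^- 2 * (2 `^ (d / 2) * n%:R `^ (d / 2)).
    apply: (@le_trans _ _ ((g^-1 * (2 * n%:R) `^ g) ^+ 2)).
      by rewrite lerXn2r ?nnegrE ?mulr_ge0 ?powR_ge0 ?invr_ge0 ?(ltW g0) //; lra.
    rewrite exprMn exprVn ler_wpM2l ?invr_ge0 ?exprn_ge0 ?(ltW g0) //.
    rewrite -powRM // -powR_mulrn ?powR_ge0 // -powRrM; apply: ler_powR; lra.
  have p0 : 0 < n%:R `^ (d / 2) :> R by rewrite powR_gt0; lra.
  rewrite -(ler_pM2r p0).
  have -> : n%:R `^ (d / 2) * n%:R `^ (d / 2) = n%:R `^ d :> R.
    rewrite -powRD; first by congr powR; lra.
    by apply/implyP => _; rewrite gt_eqF //; lra.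
  apply: le_trans (H n n0) _; rewrite -/t /K' -!mulrA ler_wpM2l //.
pose n := (Num.Def.archi_bound (K' `^ (d / 2)^-1)).+1.
have := H' n isT; apply/negP; rewrite -ltNge.
have d2 : 0 < d / 2 by rewrite divr_gt0.
have {1}-> : K' = (K' `^ (d / 2)^-1) `^ (d / 2).
  by rewrite -powRrM mulVf ?gt_eqF // powRr1.
apply: gt0_ltr_powR; rewrite ?nnegrE ?powR_ge0 //.
apply: (@lt_le_trans _ _ (Num.Def.archi_bound (K' `^ (d / 2)^-1))%:R).
  by apply: archi_boundP; exact: powR_ge0.
by rewrite ler_nat.
Qed.

Section SummingLower.
Context (R : realType) (k : scalar_kind) (m : nat) (p : 'I_m -> \bar R).
Local Notation K := (Defs.scalar R k).
Local Notation modulus := (@Defs.modulus R k).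
Hypothesis p1 : forall j, (1 <= p j)%E.

(** [sq_norm_le] bounds the real and imaginary parts of the image in l_2, which accounts for the 2
    under the root. Hölder on N entries then passes from l_2 to l_s. The entries of each v_i have
    modulus 1, so its l_q norm is N^(1/q). *)
Lemma summing_sign_matrix s q rho C n N :
  (0 < m)%N -> 1 <= s -> s <= q -> q <= 2 -> 0 < rho -> 0 < C ->
  1 / 2 < inv_sum p -> inv_sum p < 1 ->
  (forall A : ('I_m -> nat -> K) -> nat -> K, continuous_multilinear p s A ->
    ((\esum_(i in [set: {ffun 'I_m -> nat}])
        lp_norm q%:E (A (fun j => unit_seq R k (i j))) `^ rho) `^ rho^-1
     <= C%:E * op_norm p s A)%E) ->
  (0 < n)%N -> n%:R `^ (2 - 2 * inv_sum p) <= N%:R ->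
  n%:R `^ rho^-1 * N%:R `^ q^-1 <=
  C * (N%:R `^ s^-1 * Num.sqrt (2 * dyadic_bound n (2 * ln (2 * n%:R)))).
Proof.
move=> m0 s1 sq q2 rho0 C0 X2 X1 hP n0 nN.
have s0 : 0 < s by lra.
have q0 : 0 < q by lra.
have X0 : 0 < inv_sum p by lra.
have n1 : 1 <= n%:R :> R by rewrite ler1n.
have [e he] := random_sign_matrix R N n0.
set th := 2 * _ in he *.
have th0 : 0 <= th by rewrite mulr_ge0 // ln_ge0 //; lra.
have /andP[G0 _] := dyadic_bound_le R n0; rewrite -/th in G0.
set G := dyadic_bound n th in G0 *.
have G2 : 0 <= 2 * G by exact: mulr_ge0.
have NG2 : 0 <= N%:R * (2 * G) by exact: mulr_ge0.
pose v (i c : nat) : K := match insub i, insub c with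
  | Some i', Some c' => of_real k ((-1) ^+ e c' i') | _, _ => 0 end.
have vE (i : 'I_n) (c : 'I_N) : v i c = of_real k ((-1) ^+ e c i).
  by rewrite /v !valK.
apply: (summing_diag_op (N := N) (v := v) p1 m0 s1 rho0 _ C0 hP); first exact: powR_ge0.
  apply: op_norm_diag_op_le => [||||z hz] //.
  pose y c := \sum_(i < n) z i * v i c.
  have part (f : K -> R) :
      (forall z, `|f z| <= modulus z) ->
      (forall (c : 'I_n -> R) z, f (\sum_i of_real k (c i) * z i) = \sum_i c i * f (z i)) ->
      \sum_(c < N) f (y c) ^+ 2 <= N%:R * G.
    move=> f_le f_sum.
    have h := sq_norm_le th0 he (z := fun i => f (z i)) X2 X1 n0 nN.
    apply: le_trans (h _); last first.
      apply: le_trans hz; apply: ler_sum => i _.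
      by apply: ge0_ler_powR; rewrite ?nnegrE ?modulus_ge0 ?invr_ge0 ?(ltW X0).
    rewrite /sq_norm; apply: ler_sum => c _; rewrite /y -f_sum.
    rewrite le_eqVlt; apply/orP; left; apply/eqP; congr (f _ ^+ 2).
    by apply: eq_bigr => i _; rewrite vE mulrC.
  have hr := part _ (@re_part_le _ _) (@re_part_sum _ _ _).
  have hi := part _ (@im_part_le _ _) (@im_part_sum _ _ _).
  have hy : \sum_(c < N) modulus (y c) ^+ 2 <= N%:R * (2 * G).
    under eq_bigr do rewrite modulus_sqr.
    by rewrite big_split mulrCA mulr_natl mulr2n lerD.
  have := @hoelder_sum R 'I_N xpredT (s / 2) (fun c => modulus (y c) ^+ 2) (fun=> 1).
  have -> : \sum_(i < N) (modulus (y i) ^+ 2) `^ (s / 2) * 1 `^ (1 - s / 2) =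
      \sum_(c < N) modulus (y c) `^ s.
    apply: eq_bigr => c _; rewrite powR1 mulr1 -powR_mulrn ?modulus_ge0 // -powRrM.
    by congr powR; lra.
  move=> h; apply: le_trans (h _ _ _ _) _ => {h} //.
  - by rewrite divr_ge0 // ltW.
  - by rewrite ler_pdivrMr // mul1r (le_trans sq).
  - by move=> c; exact: sqr_ge0.
  rewrite sumr_const card_ord.
  have -> : (N%:R `^ s^-1 * Num.sqrt (2 * G)) `^ s = (N%:R * (2 * G)) `^ (s / 2) * N%:R `^ (1 - s / 2).
    have N0 : 0 < N%:R :> R by apply: lt_le_trans nN; rewrite powR_gt0; lra.
    rewrite [LHS]powRM ?powR_ge0 ?sqrtr_ge0 // -[X in X * _]powRrM mulVf ?gt_eqF //.
    rewrite powRr1 ?(ltW N0) // sqrt_powR // -powRrM.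
    rewrite [in RHS]powRM ?(ltW N0) // [RHS]mulrAC -powRD; last first.
      by apply/implyP => _; rewrite gt_eqF.
    have -> : s / 2 + (1 - s / 2) = 1 by rewrite addrC subrK.
    by rewrite powRr1 ?(ltW N0) // div1r [2^-1 * s]mulrC.
  rewrite ler_wpM2r ?powR_ge0 //; apply: ge0_ler_powR; rewrite ?nnegrE ?NG2 ?divr_ge0 ?(ltW s0) //.
  by apply: sumr_ge0 => c _; exact: sqr_ge0.
move=> i iN; apply: le_trans (lp_norm_ge _ N q0).
have -> // : \sum_(c < N) modulus (trunc_seq N (v i) c) `^ q = N%:R.
rewrite (eq_bigr (fun=> 1)) ?sumr_const ?card_ord // => c _.
rewrite /trunc_seq ltn_ord -[v i c]/(v (Ordinal iN) c) vE modulus_of_real.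
by rewrite normrX normrN1 expr1n powR1.
Qed.

Lemma summing_lower s q rho : (0 < m)%N ->
  1 <= s -> s <= q -> q <= 2 -> 0 < rho -> 1 / 2 < inv_sum p ->
  summing_property R k p s q rho ->
  1 / rho <= 2 * (1 - inv_sum p) * (1 / s - 1 / q).
Proof.
move=> m0 s1 sq q2 rho0 X2 [C C0 hP].
have s0 : 0 < s by lra.
have q0 : 0 < q by lra.
have [X1|X1] := leP 1 (inv_sum p).
  by have := not_summing_of_ge1 p1 m0 s1 sq rho0 C0 X1 hP.
set X := inv_sum p in X2 X1.
pose D := s^-1 - q^-1.
have D0 : 0 <= D by rewrite subr_ge0 lef_pV2.
(* The excess of 1/rho over the claimed bound. If positive, n^d would grow no faster than a power of
   log n. *)
pose d := rho^-1 - (2 - 2 * X) * D.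
have -> : 2 * (1 - X) * (1 / s - 1 / q) = (2 - 2 * X) * D by rewrite /D; lra.
rewrite leNgt; apply/negP => hd.
have d0 : 0 < d by rewrite /d; lra.
apply: (@powR_not_polylog R d (C * 2 `^ D * 32) d0) => n n0.
have n1 : 1 <= n%:R :> R by rewrite ler1n.
have np : 0 < n%:R :> R by lra.
pose a := n%:R `^ (2 - 2 * X) : R.
have a1 : 1 <= a.
  have -> : 1 = 1 `^ (2 - 2 * X) :> R by rewrite powR1.
  by apply: ge0_ler_powR; rewrite ?nnegrE //; lra.
pose N := (Num.truncn a).+1.
have /andP[Na aN] : (Num.truncn a)%:R <= a < N%:R by apply: truncn_itv; lra.
have N2 : N%:R <= 2 * a by rewrite /N -natr1; lra.
have Np : 0 < N%:R :> R by rewrite ltr0n.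
have H := summing_sign_matrix m0 s1 sq q2 rho0 C0 X2 X1 hP n0 (ltW aN).
have /andP[G0 GT] := dyadic_bound_le R n0.
set G := dyadic_bound _ _ in H G0 GT; set t := ln _ in GT *.
have t0 : 0 <= t by rewrite ln_ge0 //; lra.
(* 2 * 512 = 32^2, and the cube is raised to a fourth power so that its root is polynomial in 1 +
   t. *)
have sG : Num.sqrt (2 * G) <= 32 * (1 + t) ^+ 2.
  have G2 : 0 <= 2 * G by exact: mulr_ge0.
  have T2 : 0 <= 32 * (1 + t) ^+ 2 by rewrite mulr_ge0 ?sqr_ge0.
  rewrite -(@ler_pXn2r _ 2) ?nnegrE ?sqrtr_ge0 // sqr_sqrtr //.
  have : (1 + t) ^+ 3 <= (1 + t) ^+ 4 by rewrite ler_weXn2l //; lra.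
  have -> : (32 * (1 + t) ^+ 2) ^+ 2 = 1024 * (1 + t) ^+ 4 by ring.
  lra.
have ND : N%:R `^ D <= 2 `^ D * n%:R `^ ((2 - 2 * X) * D).
  rewrite powRrM -powRM ?powR_ge0 //.
  by apply: ge0_ler_powR; rewrite ?nnegrE ?mulr_ge0 ?powR_ge0.
have Nq : 0 < N%:R `^ q^-1 :> R by rewrite powR_gt0.
have nX : 0 < n%:R `^ ((2 - 2 * X) * D) :> R by rewrite powR_gt0.
have H1 : n%:R `^ rho^-1 <= C * (N%:R `^ D * Num.sqrt (2 * G)).
  rewrite -(ler_pM2r Nq); apply: le_trans H _.
  have -> : N%:R `^ s^-1 = N%:R `^ D * N%:R `^ q^-1 :> R.
    rewrite -powRD; first by congr powR; rewrite /D; lra.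
    by apply/implyP => _; rewrite gt_eqF.
  by rewrite le_eqVlt; apply/orP; left; apply/eqP; ring.
rewrite /d powRB; last by apply/implyP => _; rewrite gt_eqF.
rewrite ler_pdivrMr //; apply: le_trans H1 _.
rewrite -!mulrA ler_wpM2l ?(ltW C0) //.
apply: le_trans (ler_pM _ _ ND sG) _; rewrite ?powR_ge0 ?sqrtr_ge0 //.
by rewrite le_eqVlt; apply/orP; left; apply/eqP; ring.
Qed.
End SummingLower.

Theorem theorem1p2 (R : realType) (k : scalar_kind) (m : nat) (hm : (1 <= m)%N)
  (p : 'I_m -> \bar R) (hp : forall j, (1 <= p j)%E)
  (hsum : 1 / 2 < inv_sum p)
  (s q : R) (hs : 1 <= s) (hsq : s <= q) (hq : q <= 2)
  (rho : R) (hrho : 0 < rho) :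
  (s < 2 ->
   1 / rho <= (1 / s - 1 / q) * (1 / s - inv_sum p) / (1 / s - 1 / 2) ->
   summing_property R k p s q rho)
  /\
  (summing_property R k p s q rho ->
   1 / rho <= 2 * (1 - inv_sum p) * (1 / s - 1 / q)).
Proof.
split => [s2|]; last exact: summing_lower.
by apply: summing_upper => //; lra.
Qed.
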